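(* Let $\psi^{(r)}\in L^2(\mathbb{R}^2)$ be a real-valued admissible wavelet and let $\psi^{(+)}=\psi^{(r)}+\mathbf{i}\mathcal{R}_1\psi^{(r)}+\mathbf{j}\mathcal{R}_2\psi^{(r)}$ be its monogenic extension. Then for every $a>0$, $\theta\in[0,2\pi)$, $\mathbf{b}\in\mathbb{R}^2$, the family member $\psi^{(+)}_{\boldsymbol{\xi}}$, $\boldsymbol{\xi}=(a,\theta,\mathbf{b})$, is a $\theta$-monogenic signal, i.e. there is a real-valued $h\in L^2(\mathbb{R}^2)$ with $\psi^{(+)}_{\boldsymbol{\xi}}=h^{(+)}_\theta$. In contrast, if $\psi^{++}$ is a hypercomplexing mother wavelet, the family members $\psi^{++}_{\boldsymbol{\xi}}$ are not $\theta$-hypercomplex signals, i.e. there is no real-valued $h\in L^2(\mathbb{R}^2)$ with $\psi^{++}_{\boldsymbol{\xi}}=h^{(++)}_\theta$.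
   Context: $\mathbb{H}$ is the skew field of quaternions with units $\mathbf{i},\mathbf{j},\mathbf{k}$, $\mathbf{i}^2=\mathbf{j}^2=\mathbf{k}^2=\mathbf{i}\mathbf{j}\mathbf{k}=-1$. $\mathbf{r}_\theta=\begin{pmatrix}\cos\theta&-\sin\theta\\ \sin\theta&\cos\theta\end{pmatrix}$ and $R_\theta g(\mathbf{x})=g(\mathbf{r}_{-\theta}\mathbf{x})$. Fourier transform: $G(\mathbf{f})=\int_{\mathbb{R}^2}g(\mathbf{x})e^{-2\pi\mathbf{j}\mathbf{f}^T\mathbf{x}}\,d^2\mathbf{x}$. On $L^2(\mathbb{R}^2)$: the Riesz transforms $\mathcal{R}_l$ are the Fourier multipliers $-\mathbf{j}f_l/|\mathbf{f}|$, the partial Hilbert transforms $\mathcal{H}_l$ are the multipliers $-\mathbf{j}\,\mathrm{sgn}(f_l)$, $l=1,2$ (all map real functions to real functions). For real-valued $h\in L^2(\mathbb{R}^2)$: the $\theta$-monogenic signal is $h^{(+)}_\theta=R_\theta h+\mathbf{i}R_\theta\mathcal{R}_1h+\mathbf{j}R_\theta\mathcal{R}_2h$; the $\theta$-hypercomplex signal is $h^{(++)}_\theta=R_\theta h+\mathbf{i}R_\theta\mathcal{H}_1h+\mathbf{j}R_\theta\mathcal{H}_2h+\mathbf{k}R_\theta\mathcal{H}_1\mathcal{H}_2h$. A real $\psi\in L^2(\mathbb{R}^2)$ is admissible if $\int|\psi|^2=1$ and $0<(2\pi)^2\int|\Psi(\mathbf{f})|^2/|\mathbf{f}|^2\,d^2\mathbf{f}<\infty$.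 A hypercomplexing mother wavelet is $\psi^{++}=\psi^{(ee)}+\mathbf{i}\mathcal{H}_1\psi^{(ee)}+\mathbf{j}\mathcal{H}_2\psi^{(ee)}-\mathbf{k}\mathcal{H}_2\mathcal{H}_1\psi^{(ee)}$ with $\psi^{(ee)}$ real, admissible and satisfying $\psi^{(ee)}(x_1,x_2)=\psi^{(ee)}(\pm x_1,\pm x_2)=\psi^{(ee)}(x_2,x_1)$. Family member of a quaternion-valued mother wavelet $\psi$: $\psi_{\boldsymbol{\xi}}(\mathbf{x})=\frac1a\psi\big(\mathbf{r}_{-\theta}(\mathbf{x}-\mathbf{b})/a\big)$ (applied componentwise). *)

(* Defs.v *)
From HB Require Import structures.
From mathcomp Require Import all_boot all_order all_algebra.
From mathcomp Require Import ring.
From mathcomp Require Import all_classical all_reals all_analysis.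

Set Implicit Arguments.
Unset Strict Implicit.
Unset Printing Implicit Defensive.

Import Order.TTheory GRing.Theory Num.Theory.
Import numFieldNormedType.Exports.

Local Open Scope classical_set_scope.
Local Open Scope ring_scope.

(* Elements of L^2 are represented by Borel functions and identities between
   them are stated almost everywhere.  The L^2 Fourier transform, and with it
   the Riesz and partial Hilbert transforms, are given by their graphs
   (is_fourier, is_multiplier): they are defined, and single-valued, up to
   null sets only. *)

Record quat (R : Type) := Quat { q_re : R; q_i : R; q_j : R; q_k : R }.
Arguments q_re {R}.
Arguments q_i {R}.
Arguments q_j {R}.
Arguments q_k {R}.

Section QuatAlgebra.
Context {R : comNzRingType}.
Implicit Types p q : quat R.

Definition tuple_of_quat q := (q_re q, q_i q, q_j q, q_k q).
Definition quat_of_tuple (t : R * R * R * R) :=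
  Quat t.1.1.1 t.1.1.2 t.1.2 t.2.

Lemma tuple_of_quatK : cancel tuple_of_quat quat_of_tuple.
Proof. by case. Qed.

HB.instance Definition _ := Choice.copy (quat R) (can_type tuple_of_quatK).

Definition addq p q :=
  Quat (q_re p + q_re q) (q_i p + q_i q) (q_j p + q_j q) (q_k p + q_k q).
Definition oppq q := Quat (- q_re q) (- q_i q) (- q_j q) (- q_k q).
Definition mulq p q :=
  Quat (q_re p * q_re q - q_i p * q_i q - q_j p * q_j q - q_k p * q_k q)
       (q_re p * q_i q + q_i p * q_re q + q_j p * q_k q - q_k p * q_j q)
       (q_re p * q_j q - q_i p * q_k q + q_j p * q_re q + q_k p * q_i q)
       (q_re p * q_k q + q_i p * q_j q - q_j p * q_i q + q_k p * q_re q).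

Definition qreal (x : R) := Quat x 0 0 0.

Lemma addqA : associative addq.
Proof. by move=> [????] [????] [????]; congr Quat; rewrite /= addrA. Qed.
Lemma addqC : commutative addq.
Proof. by move=> [????] [????]; congr Quat; rewrite /= addrC. Qed.
Lemma add0q : left_id (qreal 0) addq.
Proof. by move=> [????]; congr Quat; rewrite /= add0r. Qed.
Lemma addNq : left_inverse (qreal 0) oppq addq.
Proof. by move=> [????]; congr Quat; rewrite /= addNr. Qed.

HB.instance Definition _ :=
  GRing.isZmodule.Build (quat R) addqA addqC add0q addNq.

Lemma mulqA : associative mulq.
Proof. by move=> [????] [????] [????]; congr Quat => /=; ring. Qed.
Lemma mul1q : left_id (qreal 1) mulq.
Proof. by move=> [????]; congr Quat => /=; ring. Qed.
Lemma mulq1 : right_id (qreal 1) mulq.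
Proof. by move=> [????]; congr Quat => /=; ring. Qed.
Lemma mulqDl : left_distributive mulq +%R.
Proof. by move=> [????] [????] [????]; congr Quat => /=; ring. Qed.
Lemma mulqDr : right_distributive mulq +%R.
Proof. by move=> [????] [????] [????]; congr Quat => /=; ring. Qed.
Lemma oneq_neq0 : qreal 1 != 0 :> quat R.
Proof. by apply/eqP => -[] /eqP; rewrite oner_eq0. Qed.

HB.instance Definition _ := GRing.Zmodule_isNzRing.Build (quat R)
  mulqA mul1q mulq1 mulqDl mulqDr oneq_neq0.

Definition qI : quat R := Quat 0 1 0 0.
Definition qJ : quat R := Quat 0 0 1 0.
Definition qK : quat R := Quat 0 0 0 1.

Lemma quat_units :
  [/\ qI * qI = - 1, qJ * qJ = - 1, qK * qK = - 1 & qI * qJ * qK = - 1].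
Proof. by split; congr Quat => /=; ring. Qed.

End QuatAlgebra.

Notation "x %:q" := (qreal x) (at level 1, format "x %:q") : ring_scope.

Notation plane R := (measurableTypeR R * measurableTypeR R)%type.

Section Signals.
Context {R : realType}.
Implicit Types (x f b : plane R) (g h u psi : plane R -> R).
Implicit Types (F G U : plane R -> quat R) (a t theta : R).

Definition leb2 : {measure set (plane R) -> \bar R} :=
  (@lebesgue_measure R \x @lebesgue_measure R)%E.

Definition qnorm (q : quat R) : R :=
  Num.sqrt (q_re q ^+ 2 + q_i q ^+ 2 + q_j q ^+ 2 + q_k q ^+ 2).

(* e^(j t) *)
Definition qexpJ t : quat R := (cos t)%:q + qJ * (sin t)%:q.

Definition dot f x : R := f.1 * x.1 + f.2 * x.2.

(* The library norm `|f| on a product type is the sup norm. *)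
Definition enorm f : R := Num.sqrt (f.1 ^+ 2 + f.2 ^+ 2).

Definition plane_rot theta x : plane R :=
  (cos theta * x.1 - sin theta * x.2, sin theta * x.1 + cos theta * x.2).

Definition rotate_fun theta g : plane R -> R := fun x => g (plane_rot (- theta) x).

Definition L2 g : Prop := g \in Lfun leb2 2%:E.

Definition qL2 G : Prop :=
  [/\ measurable_fun setT (q_re \o G), measurable_fun setT (q_i \o G),
      measurable_fun setT (q_j \o G), measurable_fun setT (q_k \o G)
    & ('N[leb2]_2%:E [EFin \o (qnorm \o G)] < +oo)%E].

Definition qintegral F : quat R :=
  Quat (\int[leb2]_x q_re (F x))%R (\int[leb2]_x q_i (F x))%R
       (\int[leb2]_x q_j (F x))%R (\int[leb2]_x q_k (F x))%R.

(* The integral converges absolutely for g in L^1 only. *)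
Definition fourier1 g : plane R -> quat R := fun f =>
  qintegral (fun x => (g x)%:q * qexpJ (- (2 * pi * dot f x))).

(* The Fourier transform on L^2 is the extension by continuity of fourier1
   from the dense subspace L^1 `&` L^2. *)
Definition is_fourier g G : Prop :=
  [/\ L2 g, qL2 G &
      exists g_ : nat -> plane R -> R,
      [/\ forall n, g_ n \in Lfun leb2 1%:E /\ L2 (g_ n),
          ('N[leb2]_2%:E [EFin \o (fun x => g_ n x - g x)%R])%E @[n --> \oo]
            --> 0%E
        & ('N[leb2]_2%:E
              [EFin \o (fun f => qnorm (fourier1 (g_ n) f - G f))%R])%E
            @[n --> \oo] --> 0%E]].

(* u is the image of g under the Fourier multiplier m. *)
Definition is_multiplier (m : plane R -> quat R) g u : Prop :=
  exists G U, [/\ is_fourier g G, is_fourier u U &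
                  {ae leb2, forall f, U f = m f * G f}].

(* p is the coordinate function f |-> f_l; the value of the Riesz symbol at
   f = 0 is irrelevant. *)
Definition riesz_symbol (p : plane R -> R) f : quat R :=
  - qJ * (p f / enorm f)%:q.
Definition hilbert_symbol (p : plane R -> R) f : quat R :=
  - qJ * (Num.sg (p f))%:q.

Definition is_riesz1 := is_multiplier (riesz_symbol fst).
Definition is_riesz2 := is_multiplier (riesz_symbol snd).
Definition is_hilbert1 := is_multiplier (hilbert_symbol fst).
Definition is_hilbert2 := is_multiplier (hilbert_symbol snd).

(* F is the theta-monogenic signal of h. *)
Definition is_monogenic_signal theta h F : Prop :=
  exists h1 h2, [/\ is_riesz1 h h1, is_riesz2 h h2 &
    {ae leb2, forall x, F x =
      (rotate_fun theta h x)%:q + qI * (rotate_fun theta h1 x)%:q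
      + qJ * (rotate_fun theta h2 x)%:q}].

(* F is the theta-hypercomplex signal of h; h12 is H_1 (H_2 h). *)
Definition is_hypercomplex_signal theta h F : Prop :=
  exists h1 h2 h12,
  [/\ is_hilbert1 h h1, is_hilbert2 h h2, is_hilbert1 h2 h12 &
    {ae leb2, forall x, F x =
      (rotate_fun theta h x)%:q + qI * (rotate_fun theta h1 x)%:q
      + qJ * (rotate_fun theta h2 x)%:q + qK * (rotate_fun theta h12 x)%:q}].

Definition admissible psi : Prop :=
  [/\ L2 psi, (\int[leb2]_x (`|psi x| ^+ 2)%:E)%E = 1%E &
    exists2 Psi, is_fourier psi Psi &
      (0 < ((2 * pi) ^+ 2)%:E *
             \int[leb2]_f (qnorm (Psi f) ^+ 2 / enorm f ^+ 2)%:E < +oo)%E].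

(* F = psi + i R_1 psi + j R_2 psi *)
Definition is_monogenic_extension psi F : Prop :=
  exists psi1 psi2, [/\ is_riesz1 psi psi1, is_riesz2 psi psi2 &
    {ae leb2, forall x, F x =
      (psi x)%:q + qI * (psi1 x)%:q + qJ * (psi2 x)%:q}].

Definition even_even_symmetric psi : Prop :=
  {ae leb2, forall x, [/\ psi (x.1, - x.2) = psi x, psi (- x.1, x.2) = psi x,
    psi (- x.1, - x.2) = psi x & psi (x.2, x.1) = psi x]}.

(* psi21 is H_2 (H_1 psi); note the sign of the k-component, opposite to the
   one in is_hypercomplex_signal. *)
Definition hypercomplexing_mother_wavelet F : Prop :=
  exists psi psi1 psi2 psi21,
  [/\ admissible psi /\ even_even_symmetric psi,
      is_hilbert1 psi psi1, is_hilbert2 psi psi2, is_hilbert2 psi1 psi21 &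
    {ae leb2, forall x, F x =
      (psi x)%:q + qI * (psi1 x)%:q + qJ * (psi2 x)%:q
      - qK * (psi21 x)%:q}].

Definition family_member a theta b F : plane R -> quat R := fun x =>
  (a^-1)%:q * F (plane_rot (- theta) ((x.1 - b.1) / a, (x.2 - b.2) / a)).

End Signals.

(* Main.v *)
(* The point [r_(-theta) ((x - b) / a)] equals [(y - c) / a] for
   [y = r_(-theta) x] and [c = r_(-theta) b], so a family member is [R_theta]
   applied to the dilated and translated components of the mother wavelet.
   Dilations and translations commute with the Fourier multipliers whose symbol
   is homogeneous of degree 0, among them the Riesz and Hilbert transforms;
   hence [h y = a^-1 psi ((y - c) / a)] has the required monogenic signal.

   In the hypercomplex case the same computation forces [h] to be this copy of
   [psi^(ee)], but the k-components have opposite signs, so that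
   [H_1 H_2 h = - H_2 H_1 h].  The product of the two symbols vanishes on the
   axes only, so the Fourier transform of [psi^(ee)] is 0 almost everywhere,
   contradicting admissibility.

   The last step needs that an L^2 function determines its Fourier transform.
   For a box Q, the identity [\int_Q g^ = \int g (1_Q)^] extends from
   L^1 `&` L^2 to L^2 because the transform of [1_Q], a combination of products
   of two functions of one variable bounded by [C / sqrt (1 + t ^ 2)], lies in
   L^2; and an integrable function is determined by its integrals over boxes. *)
Require Import Defs.
From HB Require Import structures.
From mathcomp Require Import all_boot all_order all_algebra.
From mathcomp Require Import ring lra.
From mathcomp Require Import all_classical all_reals all_analysis.
From mathcomp Require Import measurable_realfun.

Set Implicit Arguments.
Unset Strict Implicit.
Unset Printing Implicit Defensive.

Import Order.TTheory GRing.Theory Num.Theory.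
Import numFieldNormedType.Exports.

Local Open Scope classical_set_scope.
Local Open Scope ring_scope.

(** * Affine changes of variables and rotations *)

Section ChangeOfVariables.
Context {R : realType}.
Implicit Types (x c : plane R) (s t : R) (A : set (plane R)).
Local Notation leb := (@lebesgue_measure R).

Definition affine_map s c x : plane R := (s * x.1 + c.1, s * x.2 + c.2).

Lemma measurable_affine1 s t : measurable_fun setT
  ((fun y => s * y + t) : measurableTypeR R -> measurableTypeR R).
Proof.
apply: measurable_funD => //; exact: measurable_funM.
Qed.

(** Lebesgue measure is the only measure giving half-open intervals their length, so the scaled
    pushforward need only be computed on these. *)
Lemma lebesgue_measure_affine s t (B : set (measurableTypeR R)) : 0 < s ->
  measurable B -> (s%:E * leb ((fun y => s * y + t)%R @^-1` B))%E = leb B.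
Proof.
move=> s0 mB; have s1 : 0 <= s by exact: ltW.
pose T := ((fun y => s * y + t) : measurableTypeR R -> measurableTypeR R).
have mT : measurable_fun setT T by exact: measurable_affine1.
suff /(_ mT B mB) -> : forall B, measurable B ->
  leb B = mscale (NngNum s1) (pushforward leb T) B by [].
move=> {}mT; apply: lebesgue_measure_unique => //.
move=> _ [[a b] _ <-]; rewrite /= /mscale/= /pushforward.
rewrite (_ : T @^-1` _ = `](a - t) / s, (b - t) / s]%classic); last first.
  apply/seteqP; split => y /=; rewrite !in_itv/= /T;
    by rewrite ltr_pdivrMr// ler_pdivlMr// ltrBlDr lerBrDr mulrC.
rewrite !lebesgue_measure_itv/= !lte_fin ltr_pM2r ?invr_gt0// ltrD2r.
case: ifP => _; last by rewrite mule0.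
rewrite -!EFinD -EFinM; congr EFin; field; lra.
Qed.

Lemma measurable_affine_map s c : measurable_fun setT (affine_map s c).
Proof.
apply/measurable_fun_pairP; split; apply: measurable_funD => //;
  exact: measurable_funM.
Qed.

(** A product measure is determined by measurable rectangles, on which the one-dimensional scaling
    applies once in each coordinate. *)
Lemma leb2_affine s c A : 0 < s -> measurable A ->
  ((s ^+ 2)%:E * leb2 (affine_map s c @^-1` A))%E = leb2 A.
Proof.
move=> s0 mA; have s1 : 0 <= s ^+ 2 by rewrite exprn_ge0// ltW.
have mT := measurable_affine_map s c.
suff /(_ mT A mA) -> : forall A, measurable A ->
  leb2 A = mscale (NngNum s1) (pushforward leb2 (affine_map s c)) A by [].
move=> {}mT; apply: product_measure_unique.
move=> B C mB mC; rewrite /= /mscale/= /pushforward.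
rewrite (_ : affine_map s c @^-1` _ =
    ((fun y => s * y + c.1) @^-1` B) `*` ((fun y => s * y + c.2) @^-1` C));
  last by [].
rewrite /leb2 product_measure1E; last 2 first.
- by rewrite -[X in measurable X]setTI; exact: measurable_affine1.
- by rewrite -[X in measurable X]setTI; exact: measurable_affine1.
rewrite -(lebesgue_measure_affine c.1 s0 mB).
rewrite -(lebesgue_measure_affine c.2 s0 mC).
by rewrite expr2 EFinM -!muleA; congr mule; rewrite muleCA.
Qed.

(** * Almost everywhere statements and nonsingular maps *)

Lemma aeI (P Q : plane R -> Prop) : {ae leb2, forall x, P x} ->
  {ae leb2, forall x, Q x} -> {ae leb2, forall x, P x /\ Q x}.
Proof. by move=> aP aQ; apply: filterS2 aP aQ. Qed.

(** Preimages of null sets are null, phrased so that it transports almost everywhere identities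
    directly, without any measurability of [P]. *)
Definition ae_preserving (phi : plane R -> plane R) :=
  forall P : plane R -> Prop,
    {ae leb2, forall x, P x} -> {ae leb2, forall x, P (phi x)}.

Lemma ae_preserving_comp phi1 phi2 : ae_preserving phi1 ->
  ae_preserving phi2 -> ae_preserving (phi1 \o phi2).
Proof. by move=> h1 h2 P /h1 /h2. Qed.

Lemma measurable_ae_preserving phi : measurable_fun setT phi ->
  (forall A, measurable A -> leb2 A = 0%E -> leb2 (phi @^-1` A) = 0%E) ->
  ae_preserving phi.
Proof.
move=> mphi null P [A [mA A0 PA]]; exists (phi @^-1` A); split.
- by rewrite -[X in measurable X]setTI; exact: mphi.
- exact: null.
- by move=> x /= nPx; exact: PA.
Qed.

Lemma affine_map_ae_preserving s c : 0 < s -> ae_preserving (affine_map s c).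
Proof.
move=> s0; apply: measurable_ae_preserving; first exact: measurable_affine_map.
move=> A mA A0; have := leb2_affine c s0 mA; rewrite A0 => /eqP.
by rewrite mule_eq0 eqe expf_eq0/= gt_eqF//= => /eqP.
Qed.

Lemma lebesgue_measure_translate t (B : set (measurableTypeR R)) :
  measurable B -> leb ((fun y => y + t)%R @^-1` B) = leb B.
Proof.
move=> mB; rewrite -(lebesgue_measure_affine t ltr01 mB) mul1e.
by congr (leb (_ @^-1` B)); apply/funext => y; rewrite mul1r.
Qed.

(** On each horizontal line the shear is a translation, so it preserves the measures of horizontal
    sections. *)
Lemma shear1_ae_preserving t :
  ae_preserving (fun x => (x.1 + t * x.2, x.2)).
Proof.
have mphi : measurable_fun setT
    ((fun x => (x.1 + t * x.2, x.2)) : plane R -> plane R).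
  apply/measurable_fun_pairP; split; last exact: measurable_snd.
  by apply: measurable_funD => //; exact: measurable_funM.
apply: measurable_ae_preserving => // A mA A0.
(* The product measure is defined by vertical sections; uniqueness allows it to be computed by
   horizontal ones. *)
have E (B : set (plane R)) : measurable B -> leb2 B = (leb \x^ leb)%E B.
  by apply: product_measure_unique => C D mC mD; rewrite /= product_measure2E.
rewrite E; last by rewrite -[X in measurable X]setTI; exact: mphi.
rewrite -A0 [RHS]E//; apply: eq_integral => y _ /=.
rewrite -(lebesgue_measure_translate (t * y) (measurable_ysection y mA)).
by congr (leb _); apply/seteqP; split => x; rewrite /ysection /= !inE.
Qed.

Lemma shear2_ae_preserving t :
  ae_preserving (fun x => (x.1, x.2 + t * x.1)).
Proof.
have mphi : measurable_fun setT
    ((fun x => (x.1, x.2 + t * x.1)) : plane R -> plane R).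
  apply/measurable_fun_pairP; split; first exact: measurable_fst.
  by apply: measurable_funD => //; exact: measurable_funM.
apply: measurable_ae_preserving => // A mA A0.
rewrite -A0; apply: eq_integral => x _ /=.
rewrite -(lebesgue_measure_translate (t * x) (measurable_xsection x mA)).
by congr (leb _); apply/seteqP; split => y; rewrite /xsection /= !inE.
Qed.

(* A rotation with nonzero sine is a product of three shears. *)
Lemma plane_rot_ae_preserving theta : ae_preserving (plane_rot theta).
Proof.
have rot3 (phi : R) : sin phi != 0 -> ae_preserving (plane_rot phi).
  (* This [p] equals [- tan (phi / 2)], the usual slope of the two outer shears. *)
  move=> s0; pose p := (cos phi - 1) / sin phi.
  have -> : plane_rot phi = (fun x => (x.1 + p * x.2, x.2)) \o
      (fun x => (x.1, x.2 + sin phi * x.1)) \o (fun x => (x.1 + p * x.2, x.2)).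
    apply/funext => x; rewrite /plane_rot /= /p; congr pair.
      rewrite [RHS](_ : _ = cos phi * x.1 + (cos phi ^+ 2 - 1) / sin phi * x.2).
        by rewrite cos2sin2; field.
      by field.
    by field.
  by do !apply: ae_preserving_comp; try exact: shear1_ae_preserving;
    exact: shear2_ae_preserving.
have [s0|/rot3//] := eqVneq (sin theta) 0.
have /eqP : cos theta ^+ 2 = 1 by rewrite cos2sin2 s0 expr0n subr0.
rewrite sqrf_eq1 => /orP[] /eqP c1.
  have -> // : plane_rot theta = id.
  by apply/funext => -[x1 x2]; rewrite /plane_rot s0 c1 /=; congr pair; ring.
(* A half turn, which is not covered by the shears, is two quarter turns. *)
have -> : plane_rot theta = plane_rot (pi / 2) \o plane_rot (pi / 2).
  apply/funext => -[x1 x2]; rewrite /plane_rot s0 c1 /= cos_pihalf sin_pihalf.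
  by congr pair; ring.
by apply: ae_preserving_comp; apply: rot3; rewrite sin_pihalf oner_neq0.
Qed.


(** * Integrals under affine maps *)

Lemma ge0_integral_affine s c (f : plane R -> \bar R) : 0 < s ->
  measurable_fun setT f -> (forall x, 0 <= f x)%E ->
  ((s ^+ 2)%:E * \int[leb2]_x f (affine_map s c x) = \int[leb2]_x f x)%E.
Proof.
move=> s0 mf f0; have s1 : 0 <= s ^+ 2 by rewrite exprn_ge0// ltW.
have mphi := measurable_affine_map s c.
have /= := ge0_integral_pushforward mphi leb2 measurableT mf (fun x _ => f0 x).
rewrite preimage_setT => <-.
have /= <- := ge0_integral_mscale (pushforward leb2 (affine_map s c))
  measurableT (NngNum s1) mf (fun x _ => f0 x).
apply: eq_measure_integral => A mA _ /=.
exact: leb2_affine.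
Qed.

Lemma integrable_affine s c (f : plane R -> R) : 0 < s ->
  leb2.-integrable setT (EFin \o f) ->
  leb2.-integrable setT (EFin \o (f \o affine_map s c)).
Proof.
move=> s0 /integrableP[mf foo]; apply/integrableP; split.
  by apply: measurableT_comp mf _; exact: measurable_affine_map.
move: foo; rewrite -(ge0_integral_affine c s0)//; last exact: measurableT_comp.
(* If the dilated integral were infinite, so would be its positive multiple. *)
apply: contraTT; rewrite -!leNgt !leye_eq => /eqP /= ->.
by rewrite mulry gtr0_sg ?exprn_gt0// mul1e.
Qed.

Lemma Rintegral_affine s c (f : plane R -> R) : 0 < s ->
  leb2.-integrable setT (EFin \o f) ->
  s ^+ 2 * \int[leb2]_x f (affine_map s c x) = \int[leb2]_x f x.
Proof.
move=> s0 intf; have mf := measurable_int _ intf.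
have intg := integrable_affine c s0 intf.
rewrite /Rintegral -[s ^+ 2]/(fine (s ^+ 2)%:E) -fineM//; last first.
  exact: integrable_fin_num.
congr fine; rewrite integralE [in RHS]integralE muleBr//; last first.
  rewrite fin_num_adde_defr// integrable_fin_num//.
  exact: integrable_funepos.
congr (_ - _)%E.
  rewrite -[RHS](ge0_integral_affine c s0)//; last exact: measurable_funepos.
  by congr (_ * _)%E; apply: eq_integral => x _; rewrite !funeposE.
rewrite -[RHS](ge0_integral_affine c s0)//; last exact: measurable_funeneg.
by congr (_ * _)%E; apply: eq_integral => x _; rewrite !funenegE.
Qed.

End ChangeOfVariables.

(** * The Fourier transform of a dilated function *)

Section FourierDilation.
Context {R : realType}.
Implicit Types (x f c : plane R) (g u : plane R -> R) (s t phi : R).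
Local Notation leb := (@lebesgue_measure R).

(** The squares of an increasing exhaustion of the line by sets of finite measure exhaust the
    plane. *)
Lemma sigma_finite_leb2 : sigma_finite setT (@leb2 R).
Proof.
have /sigma_finiteP[F [TF ndF Foo]] := sigma_finiteT leb.
exists (fun n => F n `*` F n).
  rewrite -setXTT TF predeqE => -[x y]; split.
    move=> [/= [n _ Fnx] [k _ Fky]]; exists (maxn n k) => //; split.
      by move: x Fnx; exact/subsetPset/ndF/leq_maxl.
    by move: y Fky; exact/subsetPset/ndF/leq_maxr.
  by move=> [n _ []/= ? ?]; split; exists n.
move=> k; have [? ?] := Foo k.
split; first exact: measurableX.
rewrite [leb2 _](product_measure1E leb leb)//.
by rewrite lte_mul_pinfty// ge0_fin_numE.
Qed.


(* Fubini's theorem needs a sigma-finite structure, which is not inferred for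
   [leb2]. *)
Definition leb2sf : {sigma_finite_measure set (plane R) -> \bar R} :=
  HB.pack (Measure.sort (@leb2 R)) (Measure.class (@leb2 R))
    (Measure_isSigmaFinite.Build _ _ _ leb2 sigma_finite_leb2).

Lemma Lnorm2E u : ('N[leb2]_2%:E[EFin \o u] =
  (\int[leb2]_x (u x ^+ 2)%:E) `^ 2^-1)%E.
Proof.
rewrite unlock; congr (_ `^ _)%E; apply: eq_integral => x _ /=.
by rewrite powR_mulrn// -normrX ger0_norm// sqr_ge0.
Qed.

(** The factor [s] compensates the Jacobian [s ^+ 2] in the L^2 norm; with [s = a^-1] it is the
    normalisation of family members. *)
Definition dilate s c u x : R := s * u (affine_map s c x).

Lemma measurable_dilate s c u : measurable_fun setT u ->
  measurable_fun setT (dilate s c u).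
Proof.
move=> mu; apply: measurable_funM => //.
by apply: measurableT_comp mu _; exact: measurable_affine_map.
Qed.

Lemma Lnorm2_dilate s c u : 0 < s -> measurable_fun setT u ->
  'N[leb2]_2%:E[EFin \o dilate s c u]%E = 'N[leb2]_2%:E[EFin \o u]%E.
Proof.
move=> s0 mu; rewrite !Lnorm2E; congr (_ `^ _)%E.
rewrite -[in RHS](ge0_integral_affine c s0); last 2 first.
- by apply/measurable_EFinP; exact: measurable_funX.
- by move=> x; rewrite lee_fin sqr_ge0.
under eq_integral do rewrite exprMn EFinM.
rewrite ge0_integralZl//.
- apply/measurable_EFinP/measurable_funX.
  by apply: measurableT_comp mu _; exact: measurable_affine_map.
- by move=> x _; rewrite lee_fin sqr_ge0.
- by rewrite lee_fin sqr_ge0.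
Qed.

Lemma L2P u : L2 u <->
  measurable_fun setT u /\ ('N[leb2]_2%:E[EFin \o u] < +oo)%E.
Proof.
rewrite /L2 inE; split.
  by move=> /andP[]; rewrite !inE.
by move=> [mu Nu]; apply/andP; rewrite !inE.
Qed.

Lemma L2_dilate s c u : 0 < s -> L2 u -> L2 (dilate s c u).
Proof.
move=> s0 /L2P[mu Nu]; apply/L2P; split; first exact: measurable_dilate.
by rewrite Lnorm2_dilate.
Qed.

Lemma Lfun1_dilate s c u : 0 < s -> u \in Lfun leb2 1%:E ->
  dilate s c u \in Lfun leb2 1%:E.
Proof.
move=> s0 /Lfun1_integrable iu; apply/Lfun1_integrable.
have := integrableZl measurableT s (integrable_affine c s0 iu).
by apply: eq_integrable.
Qed.

(** * The transform as a pair of cosine integrals *)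

Definition phase phi f x : R := cos (2 * pi * dot f x + phi).

(* Since [cos (t + pi / 2) = - sin t], [phi = 0] gives the real part of the
   Fourier transform and [phi = pi / 2] its [j] part. *)
Definition cos_transform phi g f : R := \int[leb2]_x (g x * phase phi f x).

(** A real function times [e^(j t)] has neither an [i] nor a [k] component. *)
Lemma fourier1E g f : fourier1 g f =
  Quat (cos_transform 0 g f) 0 (cos_transform (pi / 2) g f) 0.
Proof.
rewrite /fourier1 /qintegral; congr Quat.
- apply: eq_Rintegral => x _ /=.
  by rewrite /phase addr0 cosN !mul0r !mul1r !subr0 addr0.
- rewrite /Rintegral integral0_eq// => x _; congr EFin => /=; ring.
- apply: eq_Rintegral => x _ /=.
  by rewrite /phase cosD cos_pihalf sin_pihalf sinN; ring.
- rewrite /Rintegral integral0_eq// => x _; congr EFin => /=; ring.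
Qed.

Lemma measurable_dot2 :
  measurable_fun setT (fun p : plane R * plane R => dot p.1 p.2).
Proof.
apply: measurable_funD; apply: measurable_funM.
- exact: measurableT_comp measurable_fst _.
- exact: measurableT_comp measurable_fst _.
- exact: measurableT_comp measurable_snd _.
- exact: measurableT_comp measurable_snd _.
Qed.

Lemma measurable_phase2 phi :
  measurable_fun setT (fun p : plane R * plane R => phase phi p.1 p.2).
Proof.
apply: (@measurableT_comp _ _ _ _ _ _ (@cos R)).
  by apply: continuous_measurable_fun => y; exact: continuous_cos.
apply: measurable_funD => //; apply: measurable_funM => //.
exact: measurable_dot2.
Qed.

Lemma measurable_phase phi f : measurable_fun setT (phase phi f).
Proof. exact: (measurable_fun_pair2 f (measurable_phase2 phi)). Qed.

Lemma phase_le1 phi f x : `|phase phi f x| <= 1.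
Proof. by rewrite ler_norml cos_geN1 cos_le1. Qed.

Lemma integrable_phase phi g f : leb2.-integrable setT (EFin \o g) ->
  leb2.-integrable setT (EFin \o (fun x => g x * phase phi f x)).
Proof.
move=> ig; have mg := measurable_int _ ig.
apply: le_integrable ig => //.
  apply/measurable_EFinP; apply: measurable_funM; first exact/measurable_EFinP.
  exact: measurable_phase.
move=> x _; rewrite lee_fin/= normrM ler_piMr//; exact: phase_le1.
Qed.

Lemma measurable_cos_transform phi g : leb2.-integrable setT (EFin \o g) ->
  measurable_fun setT (cos_transform phi g).
Proof.
move=> ig; have /measurable_EFinP mg := measurable_int _ ig.
have ing : leb2.-integrable setT (EFin \o (fun x => `|g x|)).
  exact: integrable_norm.
(* Adding [`|g|] makes the integrand nonnegative, so that Tonelli applies. *)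
pose w f := \int[leb2]_x (`|g x| + g x * phase phi f x).
have -> : cos_transform phi g = w \- cst (\int[leb2]_x `|g x|).
  apply/funext => f; rewrite /w /= RintegralD//; last exact: integrable_phase.
  by rewrite addrC addKr.
apply: measurable_funB => //.
apply: (measurableT_comp (fine_measurable measurableT)).
pose W (p : plane R * plane R) := (`|g p.2| + g p.2 * phase phi p.1 p.2)%:E.
apply: (@measurable_fun_fubini_tonelli_F _ _ _ _ R leb2sf W).
- apply/measurable_EFinP; apply: measurable_funD.
    apply: measurableT_comp => //; exact: measurableT_comp mg _.
  apply: measurable_funM; last exact: measurable_phase2.
  exact: measurableT_comp mg _.
- move=> p; rewrite lee_fin -lerBlDl sub0r lerNl.
  by rewrite (le_trans (ler_norm _))// normrN normrM ler_piMr// phase_le1.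
Qed.

Lemma phaseB phi a f x :
  phase (phi - a) f x =
  cos a * phase phi f x - sin a * phase (phi + pi / 2) f x.
Proof.
rewrite /phase !addrA cosB [X in _ - _ * X]cosD cos_pihalf sin_pihalf; ring.
Qed.

(** This turns the phase shift caused by a translation into a rotation between the real and [j]
    components, that is, multiplication by an exponential in [j]. *)
Lemma cos_transformB phi a g f : leb2.-integrable setT (EFin \o g) ->
  cos_transform (phi - a) g f =
  cos a * cos_transform phi g f - sin a * cos_transform (phi + pi / 2) g f.
Proof.
move=> ig; rewrite /cos_transform.
rewrite -RintegralZl//; last exact: integrable_phase.
rewrite -[X in _ = _ - X]RintegralZl//; last exact: integrable_phase.
rewrite -RintegralB//; last 2 first.
- exact: (integrableZl measurableT _ (integrable_phase _ _ ig)).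
- exact: (integrableZl measurableT _ (integrable_phase _ _ ig)).
by apply: eq_Rintegral => x _; rewrite phaseB; ring.
Qed.

Lemma cos_transform_dilate phi s c g f : 0 < s ->
  leb2.-integrable setT (EFin \o g) ->
  cos_transform phi (dilate s c g) f = s^-1 *
  cos_transform (phi - 2 * pi * dot f c / s) g (affine_map s^-1 (0, 0) f).
Proof.
move=> s0 ig; rewrite /cos_transform.
(* The substitution is made on the right-hand side; its factor [s ^+ 2] and the prefactor [s^-1]
   combine to the [s] of [dilate]. *)
rewrite -[X in _ = _ * X](Rintegral_affine c s0); last exact: integrable_phase.
rewrite mulrA expr2 mulKf ?gt_eqF// -RintegralZl//; last first.
  exact: integrable_affine (integrable_phase _ _ ig).
apply: eq_Rintegral => x _; rewrite /dilate mulrA; congr (_ * _).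
rewrite /phase /dot /affine_map /=; congr cos; field; lra.
Qed.

(** The transform of [dilate s c g] when [G] is that of [g]: the translation becomes an exponential
    factor and the dilation by [s] one by [s^-1]. *)
Definition dilate_fourier s c (G : plane R -> quat R) f : quat R :=
  (s^-1)%:q * qexpJ (2 * pi * dot f c / s) * G (affine_map s^-1 (0, 0) f).

Lemma fourier1_dilate s c g f : 0 < s -> leb2.-integrable setT (EFin \o g) ->
  fourier1 (dilate s c g) f = dilate_fourier s c (fourier1 g) f.
Proof.
move=> s0 ig; rewrite /dilate_fourier !fourier1E !cos_transform_dilate//.
rewrite !cos_transformB// add0r -splitr.
(* The phase [pi] arises when the [j] part, already at [pi / 2], is shifted by another [pi / 2]. *)
have -> h : cos_transform pi g h = - cos_transform 0 g h.
  rewrite /cos_transform -mulN1r -RintegralZl//; last exact: integrable_phase.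
  by apply: eq_Rintegral => x _; rewrite /phase cosDpi addr0; ring.
congr Quat => /=; ring.
Qed.

Lemma dilate_fourierE s c G f : dilate_fourier s c G f =
  let t := 2 * pi * dot f c / s in let q := G (affine_map s^-1 (0, 0) f) in
  Quat (s^-1 * (cos t * q_re q - sin t * q_j q))
       (s^-1 * (cos t * q_i q + sin t * q_k q))
       (s^-1 * (cos t * q_j q + sin t * q_re q))
       (s^-1 * (cos t * q_k q - sin t * q_i q)).
Proof. by rewrite /dilate_fourier; congr Quat => /=; ring. Qed.

(** The exponential factor has modulus 1, so only a dilation remains; hence [dilate_fourier] is an
    L^2 isometry. *)
Lemma qnorm_dilate_fourier s c G f : 0 < s ->
  qnorm (dilate_fourier s c G f) = dilate s^-1 (0, 0) (qnorm \o G) f.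
Proof.
move=> s0; rewrite dilate_fourierE /dilate /qnorm /=.
move: (G _) (_ / s) => [q0 q1 q2 q3] t /=.
have -> : s^-1 = Num.sqrt (s^-1 ^+ 2).
  by rewrite sqrtr_sqr ger0_norm// invr_ge0 ltW.
rewrite -sqrtrM ?sqr_ge0//; congr Num.sqrt.
rewrite sqrtr_sqr ger0_norm ?invr_ge0 ?ltW//.
have := cos2Dsin2 t; move: (cos t) (sin t) s^-1 => a b d ab.
rewrite -[RHS]mul1r -ab; ring.
Qed.

Lemma dilate_fourierB s c G H f :
  dilate_fourier s c G f - dilate_fourier s c H f =
  dilate_fourier s c (fun f => G f - H f) f.
Proof. by rewrite /dilate_fourier mulrBr. Qed.

(** * Dilation of the L^2 Fourier transform *)

Definition qmeasurable (G : plane R -> quat R) :=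
  [/\ measurable_fun setT (q_re \o G), measurable_fun setT (q_i \o G),
      measurable_fun setT (q_j \o G) & measurable_fun setT (q_k \o G)].

Lemma qmeasurable_qnorm G : qmeasurable G -> measurable_fun setT (qnorm \o G).
Proof.
move=> [m0 m1 m2 m3]; apply: (@measurableT_comp _ _ _ _ _ _ (@Num.sqrt R)).
  by apply: continuous_measurable_fun => y; exact: sqrt_continuous.
apply: measurable_funD; last exact: (measurable_funX 2 m3).
apply: measurable_funD; last exact: (measurable_funX 2 m2).
apply: measurable_funD; last exact: (measurable_funX 2 m1).
exact: (measurable_funX 2 m0).
Qed.

Lemma qmeasurable_dilate_fourier s c G : qmeasurable G ->
  qmeasurable (dilate_fourier s c G).
Proof.
move=> [m0 m1 m2 m3].
have mt : measurable_fun setT (fun f => 2 * pi * dot f c / s).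
  apply: measurable_funM => //; apply: measurable_funM => //.
  exact: (measurable_fun_pair1 c measurable_dot2).
have mc : measurable_fun setT (fun f => cos (2 * pi * dot f c / s)).
  apply: measurableT_comp mt.
  by apply: continuous_measurable_fun => y; exact: continuous_cos.
have ms : measurable_fun setT (fun f => sin (2 * pi * dot f c / s)).
  apply: measurableT_comp mt.
  by apply: continuous_measurable_fun => y; exact: continuous_sin.
have ma := measurable_affine_map s^-1 (0, 0).
have {}m0 := measurableT_comp m0 ma.
have {}m1 := measurableT_comp m1 ma.
have {}m2 := measurableT_comp m2 ma.
have {}m3 := measurableT_comp m3 ma.
split.
- rewrite (_ : _ \o _ = fun f => q_re (dilate_fourier s c G f))//.
  under eq_fun do rewrite dilate_fourierE /=.
  apply: measurable_funM => //.
  by apply: measurable_funB; apply: measurable_funM.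
- rewrite (_ : _ \o _ = fun f => q_i (dilate_fourier s c G f))//.
  under eq_fun do rewrite dilate_fourierE /=.
  apply: measurable_funM => //.
  by apply: measurable_funD; apply: measurable_funM.
- rewrite (_ : _ \o _ = fun f => q_j (dilate_fourier s c G f))//.
  under eq_fun do rewrite dilate_fourierE /=.
  apply: measurable_funM => //.
  by apply: measurable_funD; apply: measurable_funM.
- rewrite (_ : _ \o _ = fun f => q_k (dilate_fourier s c G f))//.
  under eq_fun do rewrite dilate_fourierE /=.
  apply: measurable_funM => //.
  by apply: measurable_funB; apply: measurable_funM.
Qed.

Lemma qL2P G : qL2 G <->
  qmeasurable G /\ ('N[leb2]_2%:E [EFin \o (qnorm \o G)] < +oo)%E.
Proof. by split=> [[]|[[]]]; split. Qed.

Lemma Lnorm2_dilate_fourier s c G : 0 < s -> qmeasurable G ->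
  ('N[leb2]_2%:E [EFin \o (qnorm \o dilate_fourier s c G)] =
   'N[leb2]_2%:E [EFin \o (qnorm \o G)])%E.
Proof.
move=> s0 mG; rewrite -[RHS](@Lnorm2_dilate s^-1 (0, 0)) ?invr_gt0//; last first.
  exact: qmeasurable_qnorm.
by apply: eq_Lnorm => f /=; rewrite qnorm_dilate_fourier.
Qed.

Lemma qmeasurable_fourier1 g : leb2.-integrable setT (EFin \o g) ->
  qmeasurable (fourier1 g).
Proof.
move=> ig; have -> : fourier1 g = fun f =>
    Quat (cos_transform 0 g f) 0 (cos_transform (pi / 2) g f) 0.
  by apply/funext => f; rewrite fourier1E.
by split; [exact: (measurable_cos_transform _ ig)|exact: measurable_cst
          |exact: (measurable_cos_transform _ ig)|exact: measurable_cst].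
Qed.

Lemma qmeasurableB G H : qmeasurable G -> qmeasurable H ->
  qmeasurable (fun f => G f - H f).
Proof. by move=> [? ? ? ?] [? ? ? ?]; split; exact: measurable_funB. Qed.

(** Dilating an approximating sequence changes neither of the two L^2 distances, so the dilated
    sequence witnesses the claim. *)
Lemma is_fourier_dilate s c g G : 0 < s -> is_fourier g G ->
  is_fourier (dilate s c g) (dilate_fourier s c G).
Proof.
move=> s0 [Lg LG [g_ [Lg_ g_g g_G]]]; have /qL2P[mG NG] := LG.
split; first exact: L2_dilate.
  apply/qL2P; split; first exact: qmeasurable_dilate_fourier.
  by rewrite Lnorm2_dilate_fourier.
have [/L2P[mg _]] := Lg.
exists (fun n => dilate s c (g_ n)); split.
- move=> n; have [L1n L2n] := Lg_ n.
  by split; [exact: Lfun1_dilate|exact: L2_dilate].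
- apply: cvg_trans g_g; apply: near_eq_cvg; apply: nearW => n.
  rewrite -(Lnorm2_dilate c s0); last first.
    by apply: measurable_funB => //; have [_ /L2P[]] := Lg_ n.
  by apply: eq_Lnorm => x /=; rewrite /dilate mulrBr.
- apply: cvg_trans g_G; apply: near_eq_cvg; apply: nearW => n.
  have /Lfun1_integrable ig_ := (Lg_ n).1.
  rewrite -(Lnorm2_dilate_fourier c s0); last first.
    by apply: qmeasurableB => //; exact: qmeasurable_fourier1.
  by apply: eq_Lnorm => f /=; rewrite fourier1_dilate// dilate_fourierB.
Qed.

End FourierDilation.

(** * Multipliers and family members *)

Section MonogenicFamily.
Context {R : realType}.
Implicit Types (x f b c : plane R) (g u : plane R -> R) (a s t theta : R).

(** The symbol is invariant under the dilation of frequencies, and as a real multiple of [j] it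
    commutes with the exponential factor. *)
Lemma is_multiplier_dilate (r : plane R -> R) s c g u : 0 < s ->
  (forall f, r (affine_map s^-1 (0, 0) f) = r f) ->
  is_multiplier (fun f => - qJ * (r f)%:q) g u ->
  is_multiplier (fun f => - qJ * (r f)%:q) (dilate s c g) (dilate s c u).
Proof.
move=> s0 rh [G [U [gG uU UG]]].
exists (dilate_fourier s c G), (dilate_fourier s c U).
split; [exact: is_fourier_dilate|exact: is_fourier_dilate|].
have is0 : 0 < s^-1 by rewrite invr_gt0.
have := affine_map_ae_preserving (0, 0) is0 UG.
apply: filterS => f E; rewrite /dilate_fourier E rh.
set q := G _; move: (r f) q => r0 [q0 q1 q2 q3].
by congr Quat => /=; ring.
Qed.

Lemma enorm_scale s f : 0 < s -> enorm (affine_map s (0, 0) f) = s * enorm f.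
Proof.
move=> s0; rewrite /enorm /affine_map/= !addr0 !exprMn -mulrDr.
by rewrite sqrtrM ?sqr_ge0// sqrtr_sqr gtr0_norm.
Qed.

Lemma is_riesz1_dilate s c g u : 0 < s -> is_riesz1 g u ->
  is_riesz1 (dilate s c g) (dilate s c u).
Proof.
move=> s0; apply: is_multiplier_dilate => // f.
rewrite enorm_scale ?invr_gt0//= addr0 -mulf_div divff ?mul1r//.
by rewrite invr_eq0 gt_eqF.
Qed.

Lemma is_riesz2_dilate s c g u : 0 < s -> is_riesz2 g u ->
  is_riesz2 (dilate s c g) (dilate s c u).
Proof.
move=> s0; apply: is_multiplier_dilate => // f.
rewrite enorm_scale ?invr_gt0//= addr0 -mulf_div divff ?mul1r//.
by rewrite invr_eq0 gt_eqF.
Qed.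

Lemma is_hilbert1_dilate s c g u : 0 < s -> is_hilbert1 g u ->
  is_hilbert1 (dilate s c g) (dilate s c u).
Proof.
move=> s0; apply: is_multiplier_dilate => // f.
by rewrite /= addr0 sgrM gtr0_sg ?invr_gt0// mul1r.
Qed.

Lemma is_hilbert2_dilate s c g u : 0 < s -> is_hilbert2 g u ->
  is_hilbert2 (dilate s c g) (dilate s c u).
Proof.
move=> s0; apply: is_multiplier_dilate => // f.
by rewrite /= addr0 sgrM gtr0_sg ?invr_gt0// mul1r.
Qed.

Definition family_shift a theta b : plane R :=
  (- (plane_rot (- theta) b).1 / a, - (plane_rot (- theta) b).2 / a).

Lemma family_memberE a theta b (F : plane R -> quat R) x :
  family_member a theta b F x = (a^-1)%:q *
    F (affine_map a^-1 (family_shift a theta b) (plane_rot (- theta) x)).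
Proof.
rewrite /family_member; congr (_ * F _).
by rewrite /affine_map /family_shift /plane_rot /=; congr pair; ring.
Qed.

Lemma family_ae_preserving a theta b : 0 < a -> ae_preserving (fun x =>
  affine_map a^-1 (family_shift a theta b) (plane_rot (- theta) x)).
Proof.
move=> a0; apply: (ae_preserving_comp (phi2 := plane_rot (- theta))).
  by apply: affine_map_ae_preserving; rewrite invr_gt0.
exact: plane_rot_ae_preserving.
Qed.

Lemma monogenic_family (psi : plane R -> R) (psip : plane R -> quat R)
    a theta b : L2 psi -> is_monogenic_extension psi psip -> 0 < a ->
  exists2 h, L2 h & is_monogenic_signal theta h (family_member a theta b psip).
Proof.
move=> Lpsi [psi1 [psi2 [H1 H2 E]]] a0.
have ia0 : 0 < a^-1 by rewrite invr_gt0.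
pose c := family_shift a theta b.
exists (dilate a^-1 c psi); first exact: L2_dilate.
exists (dilate a^-1 c psi1), (dilate a^-1 c psi2).
split; [exact: is_riesz1_dilate|exact: is_riesz2_dilate|].
apply: filterS (family_ae_preserving theta b a0 E) => x.
rewrite family_memberE => ->; rewrite /rotate_fun /dilate -/c.
by congr Quat => /=; ring.
Qed.

End MonogenicFamily.

(** * Uniqueness of the Fourier transform *)

Section Tensor.
Context d1 d2 (T1 : measurableType d1) (T2 : measurableType d2) {R : realType}.
Variables (m1 : {sigma_finite_measure set T1 -> \bar R})
  (m2 : {sigma_finite_measure set T2 -> \bar R}).
Variables (p : T1 -> R) (q : T2 -> R).
Hypotheses (ip : m1.-integrable setT (EFin \o p))
  (iq : m2.-integrable setT (EFin \o q)).

(** By Tonelli, the iterated integral of the absolute value is a product of two finite integrals. *)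
Lemma integrable_tensor :
  (m1 \x m2)%E.-integrable setT (fun z => (p z.1 * q z.2)%:E).
Proof.
have /measurable_EFinP mp := measurable_int _ ip.
have /measurable_EFinP mq := measurable_int _ iq.
have mz : measurable_fun setT (fun z : T1 * T2 => (p z.1 * q z.2)%:E).
  apply/measurable_EFinP; apply: measurable_funM.
    exact: measurableT_comp mp measurable_fst.
  exact: measurableT_comp mq measurable_snd.
apply/(integrable12ltyP m1 m2 mz).
have [_ fp] := integrableP _ _ _ ip; have [_ fq] := integrableP _ _ _ iq.
under eq_integral => x _.
  under eq_integral => y _ do rewrite /= normrM EFinM.
  rewrite ge0_integralZl//; last first.
    by apply/measurable_EFinP; exact: measurableT_comp.
  over.
rewrite ge0_integralZr//.
- rewrite lte_mul_pinfty//; first exact: integral_ge0.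
  by rewrite ge0_fin_numE//; exact: integral_ge0.
- by apply/measurable_EFinP; exact: measurableT_comp.
- exact: integral_ge0.
Qed.

Lemma Rintegral_tensor : \int[(m1 \x m2)%E]_z (p z.1 * q z.2) =
  (\int[m1]_x p x) * (\int[m2]_y q y).
Proof.
rewrite /Rintegral -(integral12_prod_meas1 integrable_tensor) /fubini_F /=.
have fq := integrable_fin_num measurableT iq.
have fp := integrable_fin_num measurableT ip.
under eq_integral => x _.
  under eq_integral => y _ do rewrite EFinM.
  rewrite (integralZl measurableT iq) -[X in (_ * X)%E](fineK fq).
  over.
rewrite (integralZr measurableT ip) fineM//.
Qed.

End Tensor.

Section FourierUniqueness.
Context {R : realType}.
Implicit Types (x f c : plane R) (g h u w : plane R -> R) (a s t phi : R).
Local Notation leb := (@lebesgue_measure R).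

(** * The multiplication formula for integrable functions *)

Lemma phaseC phi f x : phase phi f x = phase phi x f.
Proof. by rewrite /phase /dot (mulrC f.1) (mulrC f.2). Qed.

(** Fubini for [h f * g x * phase phi f x]: the phase is bounded by 1 and symmetric in [f] and
    [x]. *)
Lemma cos_transform_duality phi g h : leb2.-integrable setT (EFin \o g) ->
  leb2.-integrable setT (EFin \o h) ->
  \int[leb2]_f (cos_transform phi g f * h f) =
  \int[leb2]_x (g x * cos_transform phi h x).
Proof.
move=> ig ih.
pose W (z : plane R * plane R) := (h z.1 * g z.2 * phase phi z.1 z.2)%:E.
have it := @integrable_tensor _ _ _ _ _ (@leb2sf R) (@leb2sf R) _ _ ih ig.
have /measurable_EFinP mt := measurable_int _ it.
have iW : (@leb2sf R \x @leb2sf R)%E.-integrable setT W.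
  apply: (le_integrable _ _ _ it) => //.
    apply/measurable_EFinP; apply: measurable_funM.
      exact: mt.
    exact: measurable_phase2.
  by move=> z _; rewrite lee_fin/= normrM ler_piMr//; exact: phase_le1.
have := Fubini iW; rewrite /W /= => /(congr1 fine) E.
transitivity (fine (\int[leb2]_x \int[leb2]_y (h x * g y * phase phi x y)%:E)).
  congr fine; apply: eq_integral => f _.
  have ip := integrable_phase phi f ig.
  rewrite mulrC EFinM /cos_transform /Rintegral fineK;
    last exact: integrable_fin_num.
  rewrite -integralZl//; apply: eq_integral => x _.
  by rewrite -EFinM mulrA.
rewrite [LHS]E; congr fine; apply: eq_integral => x _.
have ip := integrable_phase phi x ih.
rewrite EFinM /cos_transform /Rintegral fineK; last exact: integrable_fin_num.
rewrite -integralZl//; apply: eq_integral => f _.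
by rewrite -EFinM phaseC; congr EFin; ring.
Qed.

(** * Transforms of intervals and boxes *)

Definition cos_transform1 phi (p : R -> R) t : R :=
  \int[leb]_y (p y * cos (2 * pi * (t * y) + phi)).

Lemma continuous_phase1 phi t :
  continuous (fun y : R => cos (2 * pi * (t * y) + phi)).
Proof.
move=> y; apply: continuous_comp; last exact: continuous_cos.
apply: cvgD; last exact: cvg_cst.
apply: cvgM; first exact: cvg_cst.
by apply: cvgM; [exact: cvg_cst|exact: cvg_id].
Qed.

Lemma measurable_phase1 phi t : measurable_fun setT
  ((fun y => cos (2 * pi * (t * y) + phi)) :
    measurableTypeR R -> measurableTypeR R).
Proof. exact: continuous_measurable_fun (@continuous_phase1 phi t). Qed.

Lemma integrable_phase1_itv phi t (u v : R) :
  leb.-integrable `[u, v] (EFin \o (fun y => cos (2 * pi * (t * y) + phi))).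
Proof.
apply: continuous_compact_integrable; first exact: segment_compact.
by apply: continuous_subspaceT; exact: continuous_phase1.
Qed.

Lemma cos_transform1_itv phi (u v : R) t :
  cos_transform1 phi \1_(`]u, v]%classic) t =
  \int[leb]_(y in `[u, v]) cos (2 * pi * (t * y) + phi).
Proof.
have i1 := integrable_phase1_itv phi t u v.
rewrite -Rintegral_itv_obnd_cbnd; last first.
  by apply: integrableS i1 => //; exact: subset_itv_oc_cc.
rewrite [RHS]Rintegral_mkcond; apply: eq_Rintegral => y _.
by rewrite patchE indicE; case: ifPn => yA; rewrite ?mul1r ?mul0r.
Qed.

(** The transform [I] satisfies [|I| <= v - u] trivially and [|t I| <= 1] by integrating the cosine;
    adding the squares bounds [(1 + t ^ 2) I ^ 2] uniformly in [phi] and [t]. *)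
Lemma cos_transform1_itv_sqr_le (u v : R) : exists M, forall phi t,
  cos_transform1 phi \1_(`]u, v]%classic) t ^+ 2 <= M / (1 + t ^+ 2).
Proof.
have [uv|vu] := ltP u v; last first.
  exists 0 => phi t; rewrite mul0r /cos_transform1 set_itv_ge -?leNgt//.
  under eq_Rintegral do rewrite indic0 mul0r.
  by rewrite /Rintegral integral0 expr0n.
exists ((v - u) ^+ 2 + 1) => phi t; rewrite cos_transform1_itv.
set I := Rintegral _ _ _.
have i1 := integrable_phase1_itv phi t u v.
have Ile : `|I| <= v - u.
  apply: le_trans (le_normr_Rintegral _ i1) _ => //.
  have -> : v - u = \int[leb]_(y in `[u, v]) 1.
    by rewrite Rintegral_cst//= lebesgue_measure_itv/= lte_fin uv mul1r.
  apply: le_Rintegral => //.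
  - exact: integrable_norm.
  - apply: continuous_compact_integrable; first exact: segment_compact.
    by apply: continuous_subspaceT => ?; exact: cvg_cst.
  - by move=> y _; rewrite ler_norml cos_geN1 cos_le1.
have tI : `|t * I| <= 1.
  have [->|t0] := eqVneq t 0; first by rewrite mul0r normr0.
  have pit0 : 2 * pi * t != 0.
    by rewrite !mulf_neq0// ?pnatr_eq0// gt_eqF// pi_gt0.
  (* The antiderivative is [sin (2 pi t y + phi) / (2 pi t)]; [t] times its increment is at most
     [2 / (2 pi)] in absolute value. *)
  pose L : R -> R := (2 * pi * t) *: (@idfun R) + cst phi.
  pose F : R -> R := (2 * pi * t)^-1 *: (sin \o L).
  have dF (y : R) : is_derive y (1 : R) F (cos (2 * pi * (t * y) + phi)).
    apply: is_derive_eq; rewrite /L !fctE /cst /idfun.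
    rewrite addr0.
    rewrite -[LHS]/((2 * pi * t)^-1 *
      (cos (2 * pi * t * y + phi) * (2 * pi * t * 1))).
    by rewrite mulr1 mulrCA mulVf// mulr1 -!mulrA.
  have -> : I = F v - F u.
    rewrite /I /Rintegral (@continuous_FTC2 _ _ F)//.
    - by apply: continuous_subspaceT; exact: continuous_phase1.
    - split.
      + by move=> y _; exact: ex_derive.
      + apply/cvg_at_right_filter/differentiable_continuous.
        by apply/derivable1_diffP; exact: ex_derive.
      + apply/cvg_at_left_filter/differentiable_continuous.
        by apply/derivable1_diffP; exact: ex_derive.
    - by move=> y _; rewrite derive1E; exact: derive_val.
  have -> : t * (F v - F u) = (sin (L v) - sin (L u)) / (2 * pi).
    have FE (y : R) : F y = (2 * pi * t)^-1 * sin (L y) by [].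
    rewrite !FE; have : 2 * pi != 0 :> R by rewrite mulf_neq0// gt_eqF// pi_gt0.
    by move: (2 * pi) => p p0; field; rewrite t0 p0.
  have pi1 : (1 : R) <= pi by have := pi_ge2 R; lra.
  rewrite normrM normfV (@gtr0_norm _ (2 * pi)) ?mulr_gt0 ?pi_gt0//.
  rewrite ler_pdivrMr ?mulr_gt0 ?pi_gt0// mul1r.
  apply: le_trans (ler_normB _ _) _.
  have s1 (y : R) : `|sin y| <= 1 by rewrite ler_norml sin_geN1 sin_le1.
  have := s1 (L v); have := s1 (L u); lra.
rewrite ler_pdivlMr ?ltr_pwDl ?sqr_ge0// mulrDr mulr1 -exprMn [I * t]mulrC.
apply: lerD.
  by rewrite -real_normK ?num_real// lerXn2r ?nnegrE// subr_ge0 ltW.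
by rewrite -real_normK ?num_real// exprn_ile1.
Qed.

(** The arctangent gives [pi / 2] on the positive half-line, and the function is even. *)
Lemma integrable_oneDsqrV :
  leb.-integrable setT (EFin \o (fun t : R => (1 + t ^+ 2)^-1)).
Proof.
pose k := EFin \o (fun t : R => (1 + t ^+ 2)^-1).
have k0 t : (0 <= k t)%E by rewrite lee_fin invr_ge0 addr_ge0// sqr_ge0.
have mk : measurable_fun setT (k : measurableTypeR R -> \bar R).
  apply/measurable_EFinP; apply: continuous_measurable_fun.
  exact: continuous_oneDsqrV.
have kp : (\int[leb]_(t in `[0%R, +oo[) k t = (pi / 2)%:E)%E.
  exact: integral0y_oneDsqr.
have kn : (\int[leb]_(t in `]-oo, 0%R]) k t = (pi / 2)%:E)%E.
  rewrite -kp ge0_integration_by_substitution0//.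
  by apply: eq_integral => t _; rewrite /k /= sqrrN.
apply/integrableP; split => //.
under eq_integral => t _ do rewrite gee0_abs//.
have -> : [set: measurableTypeR R] = `]-oo, 0] `|` `]0, +oo[.
  apply/seteqP; split => // t _ /=; rewrite !in_itv/= andbT.
  by apply/orP; case: (ltP 0 (t : R)) => _; rewrite ?orbT.
rewrite ge0_integral_setU//.
- rewrite kn lte_add_pinfty ?ltry//.
  rewrite (@le_lt_trans _ _ (pi / 2)%:E) ?ltry// -kp.
  apply: ge0_subset_integral => //; first exact: measurable_funTS.
  by move=> t /=; rewrite !in_itv/= !andbT; exact: ltW.
- exact: measurable_funTS.
- apply/disj_setPS => t [/=]; rewrite !in_itv/= andbT => t0 /lt_le_trans/(_ t0).
  by rewrite ltxx.
Qed.

Lemma integrable_indic_lty d (T : measurableType d)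
    (m : {measure set T -> \bar R}) (A : set T) :
  measurable A -> (m A < +oo)%E -> m.-integrable setT (EFin \o \1_A).
Proof.
move=> mA Aoo; apply/integrableP; split.
  by apply/measurable_EFinP; exact: measurable_indic.
rewrite (eq_integral (fun z => (\1_A z)%:E)) ?integral_indic ?setIT// => z _.
by rewrite gee0_abs// lee_fin.
Qed.

(** The addition formula for the cosine, with [phi] attached to the second coordinate; the product
    of sines is written as a product of cosines shifted by [pi / 2]. *)
Lemma cos_transform_indicX phi (A B : set (measurableTypeR R)) x :
  measurable A -> measurable B -> (leb A < +oo)%E -> (leb B < +oo)%E ->
  cos_transform phi \1_(A `*` B) x =
  cos_transform1 0 \1_A x.1 * cos_transform1 phi \1_B x.2 -
  cos_transform1 (pi / 2) \1_A x.1 * cos_transform1 (phi + pi / 2) \1_B x.2.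
Proof.
move=> mA mB Aoo Boo.
have iph psi t (C : set (measurableTypeR R)) :
    measurable C -> (leb C < +oo)%E -> leb.-integrable setT
      (EFin \o (fun y => \1_C y * cos (2 * pi * (t * y) + psi))).
  move=> mC Coo.
  have iC : leb.-integrable setT (EFin \o \1_C) by exact: integrable_indic_lty.
  apply: (le_integrable _ _ _ iC) => //.
    apply/measurable_EFinP; apply: measurable_funM => //.
    exact: measurable_phase1.
  move=> y _; rewrite lee_fin/= normrM ler_piMr// ler_norml.
  by rewrite cos_geN1 cos_le1.
have tens := @Rintegral_tensor _ _ _ _ R leb leb.
have itens := @integrable_tensor _ _ _ _ R leb leb.
rewrite /cos_transform1 -!tens; do ?exact: iph.
rewrite -RintegralB//; last 2 first.
- exact: (itens _ _ (iph 0 x.1 A mA Aoo) (iph phi x.2 B mB Boo)).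
- exact: (itens _ _ (iph (pi / 2) x.1 A mA Aoo)
    (iph (phi + pi / 2) x.2 B mB Boo)).
apply: eq_Rintegral => y _.
have -> : \1_(A `*` B) y = \1_A y.1 * \1_B y.2 :> R.
  rewrite !indicE in_setX.
  by case: (_ \in A); case: (_ \in B); rewrite ?mul1r ?mul0r.
have -> : phase phi x y =
    cos (2 * pi * (x.1 * y.1) + 0) * cos (2 * pi * (x.2 * y.2) + phi) -
    cos (2 * pi * (x.1 * y.1) + pi / 2) *
      cos (2 * pi * (x.2 * y.2) + (phi + pi / 2)).
  rewrite /phase /dot mulrDr -[in LHS]addrA cosD addr0.
  by rewrite addrA !(cosD _ (pi / 2)) cos_pihalf sin_pihalf; ring.
ring.
Qed.

Lemma lebesgue_measure_oc_lty s t : (leb `]s, t]%classic < +oo)%E.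
Proof.
by rewrite lebesgue_measure_itv/=; case: ifP => _; rewrite -?EFinD ltry.
Qed.

(** Half-open sides match the intervals [ocitv], which generate the Borel sets and are closed under
    intersection. *)
Definition box s1 t1 s2 t2 : set (plane R) :=
  `]s1, t1]%classic `*` `]s2, t2]%classic.

Lemma measurable_box s1 t1 s2 t2 : measurable (box s1 t1 s2 t2).
Proof. by apply: measurableX; exact: measurable_itv. Qed.

Lemma integrable_indic_box s1 t1 s2 t2 :
  leb2.-integrable setT (EFin \o (\1_(box s1 t1 s2 t2) : plane R -> R)).
Proof.
apply: integrable_indic_lty; first exact: measurable_box.
rewrite [leb2 _](product_measure1E leb leb)//; do ?exact: measurable_itv.
apply: lte_mul_pinfty => //; last exact: lebesgue_measure_oc_lty.
by rewrite ge0_fin_numE//; exact: lebesgue_measure_oc_lty.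
Qed.

(** The square is dominated by a constant times [1 / ((1 + x.1 ^ 2) (1 + x.2 ^ 2))], a product of
    integrable functions of one variable. *)
Lemma L2_cos_transform_box phi s1 t1 s2 t2 :
  L2 (cos_transform phi \1_(box s1 t1 s2 t2)).
Proof.
have iB := integrable_indic_box s1 t1 s2 t2.
have [M1 M1le] := cos_transform1_itv_sqr_le s1 t1.
have [M2 M2le] := cos_transform1_itv_sqr_le s2 t2.
apply/L2P; split; first exact: measurable_cos_transform.
rewrite Lnorm2E poweR_lty//.
have ik := @integrable_tensor _ _ _ _ R leb leb _ _
  integrable_oneDsqrV integrable_oneDsqrV.
have {}ik := integrableZl measurableT (4 * M1 * M2) ik.
have [_] := integrableP _ _ _ ik; apply: le_lt_trans.
apply: ge0_le_integral => //.
- by move=> x _; rewrite lee_fin sqr_ge0.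
- apply/measurable_EFinP/measurable_funX.
  exact: measurable_cos_transform.
- by apply: measurableT_comp => //; exact: (measurable_int _ ik).
move=> x _; rewrite -EFinM lee_fin (le_trans _ (ler_norm _))//.
rewrite cos_transform_indicX; do ?exact: lebesgue_measure_oc_lty;
  do ?exact: measurable_itv.
have := M1le 0 x.1; have := M1le (pi / 2) x.1.
have := M2le phi x.2; have := M2le (phi + pi / 2) x.2.
move: (cos_transform1 _ _ _) (cos_transform1 _ _ _)
  (cos_transform1 _ _ _) (cos_transform1 _ _ _) => a b c d.
rewrite (_ : 4 * M1 * M2 * _ =
  4 * ((M1 / (1 + x.1 ^+ 2)) * (M2 / (1 + x.2 ^+ 2)))); last first.
  by move: (1 + x.1 ^+ 2)^-1 (1 + x.2 ^+ 2)^-1 => i1 i2; ring.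
move: (M1 / _) (M2 / _) => P Q dQ cQ bP aP.
have acPQ : (a * c) ^+ 2 <= P * Q by rewrite exprMn ler_pM ?sqr_ge0.
have bdPQ : (b * d) ^+ 2 <= P * Q by rewrite exprMn ler_pM ?sqr_ge0.
(* Source of the constant 4: [(a c - b d)^2 = 2 (a c)^2 + 2 (b d)^2 - (a c + b d)^2 <= 4 P Q]. *)
have : 0 <= (a * c + b * d) ^+ 2 by exact: sqr_ge0.
nra.
Qed.

(** * The multiplication formula for the L^2 transform *)

Lemma Rintegral_mul_cvg (u_ : nat -> plane R -> R) u w :
  (forall n, measurable_fun setT (u_ n)) -> measurable_fun setT u -> L2 w ->
  (forall n, leb2.-integrable setT (EFin \o (u_ n \* w))) ->
  leb2.-integrable setT (EFin \o (u \* w)) ->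
  'N[leb2]_2%:E[EFin \o (fun x => (u_ n x - u x)%R)]%E @[n --> \oo] --> 0%E ->
  \int[leb2]_x (u_ n x * w x) @[n --> \oo] --> \int[leb2]_x (u x * w x).
Proof.
move=> mu_ mu /L2P[mw Nw] iu_ iu u_u.
apply/subr_cvg0; apply/norm_cvg0P.
suff /fine_cvgP[_] :
    (`|\int[leb2]_x (u_ n x * w x) - \int[leb2]_x (u x * w x)|)%:E
    @[n --> \oo] --> 0%:E by [].
pose b n := ('N[leb2]_2%:E[EFin \o (fun x => (u_ n x - u x)%R)] *
  'N[leb2]_2%:E[EFin \o w])%E.
apply: (@squeeze_cvge _ _ _ _ (cst 0%E) _ b); last 2 first.
- exact: cvg_cst.
- have fw : 'N[leb2]_2%:E[EFin \o w]%E \is a fin_num.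
    by rewrite ge0_fin_numE ?Lnorm_ge0.
  by have := cvgeZr fw u_u; rewrite mul0e.
apply: nearW => n; rewrite lee_fin normr_ge0/=.
rewrite -RintegralB//; last exact: iu_.
pose D x := (u_ n x - u x) * w x.
(* Cauchy-Schwarz, as the Hölder inequality with both exponents 2. *)
apply: (@le_trans _ _ ('N[leb2]_1[EFin \o D])%E); last first.
  apply: hoelder => //; first exact: measurable_funB.
  by rewrite [RHS]splitr !div1r.
have iD : leb2.-integrable setT (EFin \o D).
  have := integrableB measurableT (iu_ n) iu.
  by apply: eq_integrable => // x _; rewrite /D /= -EFinB mulrBl.
rewrite Lnorm1; under eq_Rintegral do rewrite -mulrBl.
rewrite EFin_normr_Rintegral//.
apply: le_abse_integral => //.
exact: (measurable_int _ iD).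
Qed.

(** The transform of an integrable function is bounded by its L^1 norm. *)
Lemma integrable_cos_transformM phi g h : leb2.-integrable setT (EFin \o g) ->
  leb2.-integrable setT (EFin \o h) ->
  leb2.-integrable setT (EFin \o (cos_transform phi g \* h)).
Proof.
move=> ig ih; have ih' := integrableZl measurableT (\int[leb2]_x `|g x|) ih.
have /measurable_EFinP mh := measurable_int _ ih.
apply: (le_integrable _ _ _ ih') => //.
  apply/measurable_EFinP; apply: measurable_funM => //.
  exact: measurable_cos_transform.
move=> f _; rewrite -EFinM lee_fin !normrM; apply: ler_wpM2r => //.
have ip := integrable_phase phi f ig.
apply: le_trans (le_normr_Rintegral measurableT ip) _.
rewrite [leRHS]ger0_norm ?Rintegral_ge0//; apply: le_Rintegral => //.
- exact: integrable_norm.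
- exact: integrable_norm.
- by move=> x _; rewrite normrM ler_piMr// phase_le1.
Qed.

(** Both sides of the multiplication formula for [g_ n] converge: the left one because [h] is in
    L^2, the right one because its transform is. *)
Lemma cos_transform_limit phi (g_ : nat -> plane R -> R) g v h :
  (forall n, leb2.-integrable setT (EFin \o g_ n)) ->
  (forall n, L2 (g_ n)) -> L2 g ->
  'N[leb2]_2%:E[EFin \o (fun x => (g_ n x - g x)%R)]%E @[n --> \oo] --> 0%E ->
  L2 v ->
  'N[leb2]_2%:E[EFin \o (fun f => (cos_transform phi (g_ n) f - v f)%R)]%E
    @[n --> \oo] --> 0%E ->
  leb2.-integrable setT (EFin \o h) -> L2 h -> L2 (cos_transform phi h) ->
  \int[leb2]_f (v f * h f) = \int[leb2]_x (g x * cos_transform phi h x).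
Proof.
move=> ig_ Lg_ Lg g_g Lv g_v ih Lh Lch.
have iL2 u w : L2 u -> L2 w -> leb2.-integrable setT (EFin \o (u \* w)).
  by move=> Lu Lw; apply/Lfun1_integrable; exact: Lfun2_mul_Lfun1.
have c1 : \int[leb2]_f (cos_transform phi (g_ n) f * h f) @[n --> \oo] -->
    \int[leb2]_f (v f * h f).
  apply: Rintegral_mul_cvg => //.
  - by move=> n; exact: measurable_cos_transform.
  - by have /L2P[] := Lv.
  - by move=> n; exact: integrable_cos_transformM.
  - exact: iL2.
have c2 : \int[leb2]_x (g_ n x * cos_transform phi h x) @[n --> \oo] -->
    \int[leb2]_x (g x * cos_transform phi h x).
  apply: Rintegral_mul_cvg => //.
  - by move=> n; have /L2P[] := Lg_ n.
  - by have /L2P[] := Lg.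
  - by move=> n; exact: iL2.
  - exact: iL2.
have E : (fun n => \int[leb2]_f (cos_transform phi (g_ n) f * h f)) =
    (fun n => \int[leb2]_x (g_ n x * cos_transform phi h x)).
  by apply/funext => n; rewrite cos_transform_duality.
rewrite E in c1; exact: cvg_unique c1 c2.
Qed.

Lemma le_Lnorm2 u w : measurable_fun setT u -> measurable_fun setT w ->
  (forall x, `|u x| <= `|w x|) ->
  ('N[leb2]_2%:E[EFin \o u] <= 'N[leb2]_2%:E[EFin \o w])%E.
Proof.
move=> mu mw uw; rewrite !Lnorm2E.
have sq0 (v : plane R -> R) : (0 <= \int[leb2]_x (v x ^+ 2)%:E)%E.
  by apply: integral_ge0 => x _; rewrite lee_fin sqr_ge0.
rewrite gt0_ler_poweR ?in_itv/= ?leey ?sq0 ?invr_ge0//.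
apply: ge0_le_integral => //.
- by move=> x _; rewrite lee_fin sqr_ge0.
- exact/measurable_EFinP/measurable_funX.
- exact/measurable_EFinP/measurable_funX.
by move=> x _; rewrite lee_fin -(real_normK (num_real (u x)))
  -(real_normK (num_real (w x))) lerXn2r ?nnegrE.
Qed.

Lemma le_qnorm (q : quat R) :
  [/\ `|q_re q| <= `|qnorm q|, `|q_i q| <= `|qnorm q|,
      `|q_j q| <= `|qnorm q| & `|q_k q| <= `|qnorm q|].
Proof.
case: q => q0 q1 q2 q3; rewrite /qnorm (ger0_norm (sqrtr_ge0 _))/=.
have := sqr_ge0 q0; have := sqr_ge0 q1; have := sqr_ge0 q2; have := sqr_ge0 q3.
move=> h3 h2 h1 h0.
by split; rewrite -sqrtr_sqr ler_wsqrtr//; lra.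
Qed.

Lemma qL2_components (G : plane R -> quat R) : qL2 G ->
  [/\ L2 (q_re \o G), L2 (q_i \o G), L2 (q_j \o G) & L2 (q_k \o G)].
Proof.
move=> /qL2P[mG NG]; have mN := qmeasurable_qnorm mG.
case: mG => m0 m1 m2 m3.
split; apply/L2P; split => //; apply: le_lt_trans NG; apply: le_Lnorm2 => // f;
  by have [] := le_qnorm (G f).
Qed.

Lemma Lnorm2_cvg0_le (u_ w_ : nat -> plane R -> R) :
  (forall n, measurable_fun setT (u_ n)) ->
  (forall n, measurable_fun setT (w_ n)) ->
  (forall n x, `|u_ n x| <= `|w_ n x|) ->
  'N[leb2]_2%:E[EFin \o w_ n]%E @[n --> \oo] --> 0%E ->
  'N[leb2]_2%:E[EFin \o u_ n]%E @[n --> \oo] --> 0%E.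
Proof.
move=> mu mw uw w0; apply: (squeeze_cvge _ (cvg_cst 0%E) w0).
by apply: nearW => n; rewrite Lnorm_ge0 le_Lnorm2.
Qed.

(** Each component is dominated by [qnorm], so the real and [j] components of the approximating
    transforms converge in L^2 separately. *)
Lemma is_fourier_duality g G h : is_fourier g G ->
  leb2.-integrable setT (EFin \o h) -> L2 h ->
  (forall phi, L2 (cos_transform phi h)) ->
  \int[leb2]_f (q_re (G f) * h f) = \int[leb2]_x (g x * cos_transform 0 h x) /\
  \int[leb2]_f (q_j (G f) * h f) =
    \int[leb2]_x (g x * cos_transform (pi / 2) h x).
Proof.
move=> [Lg LG [g_ [Lg_ g_g g_G]]] ih Lh Lch.
have ig_ n : leb2.-integrable setT (EFin \o g_ n).
  by apply/Lfun1_integrable; exact: (Lg_ n).1.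
have [L0 L1 L2' L3] := qL2_components LG.
have mD n : qmeasurable (fun f => fourier1 (g_ n) f - G f).
  by apply: qmeasurableB; [exact: qmeasurable_fourier1|have /qL2P[] := LG].
have mN n := qmeasurable_qnorm (mD n).
have qD n f := le_qnorm (fourier1 (g_ n) f - G f).
split; apply: (cos_transform_limit ig_ (fun n => (Lg_ n).2) Lg g_g) => //.
- apply: Lnorm2_cvg0_le g_G => // n.
    by have [+ _ _ _] := mD n; under eq_fun do rewrite fourier1E.
  by move=> f; have [+ _ _ _] := qD n f; rewrite fourier1E.
- apply: Lnorm2_cvg0_le g_G => // n.
    by have [_ _ + _] := mD n; under eq_fun do rewrite fourier1E.
  by move=> f; have [_ _ + _] := qD n f; rewrite fourier1E.
Qed.

(** The approximating transforms have no [i] and [k] components, so those of [G] are dominated by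
    errors tending to 0. *)
Lemma is_fourier_ik0 g G : is_fourier g G ->
  {ae leb2, forall f, q_i (G f) = 0 /\ q_k (G f) = 0}.
Proof.
move=> [Lg LG [g_ [Lg_ g_g g_G]]].
have ig_ n : leb2.-integrable setT (EFin \o g_ n).
  by apply/Lfun1_integrable; exact: (Lg_ n).1.
have [L0 L1 L2' L3] := qL2_components LG.
have mD n : qmeasurable (fun f => fourier1 (g_ n) f - G f).
  by apply: qmeasurableB; [exact: qmeasurable_fourier1|have /qL2P[] := LG].
have mN n := qmeasurable_qnorm (mD n).
have qD n f := le_qnorm (fourier1 (g_ n) f - G f).
have null u : L2 u ->
    (forall n f, `|u f| <= `|qnorm (fourier1 (g_ n) f - G f)|) ->
    {ae leb2, forall f, u f = 0}.
  move=> /L2P[mu _] uq.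
  (* The constant sequence of the norms of [u] tends to 0, so this norm is 0. *)
  have /(cvg_unique (@ereal_hausdorff R)) u0 :
      'N[leb2]_2%:E[EFin \o u]%E @[n --> \oo] --> 0%E.
    exact: Lnorm2_cvg0_le g_G.
  have {}u0 : 'N[leb2]_2%:E[EFin \o u]%E = 0%E by apply/esym/u0; exact: cvg_cst.
  have mEu : measurable_fun setT (EFin \o u) by exact/measurable_EFinP.
  have := Lnorm_eq0_eq0 mEu _ u0; rewrite lte_fin ltr0n => /(_ isT).
  by apply: filterS => f /(_ I) [].
have i0 : {ae leb2, forall f, q_i (G f) = 0}.
  apply: null => // n f; have [_ + _ _] := qD n f.
  by rewrite fourier1E /= sub0r normrN.
have k0 : {ae leb2, forall f, q_k (G f) = 0}.
  apply: null => // n f; have [_ _ _ +] := qD n f.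
  by rewrite fourier1E /= sub0r normrN.
exact: aeI.
Qed.

(** * Functions with vanishing integrals over boxes *)

Lemma integral_eq0_dynkin d1 d2 (X : measurableType d1) (T : measurableType d2)
    (m : {measure set X -> \bar R}) (p : X -> T) (C : set (set T))
    (D : set X) (F : X -> \bar R) :
  @measurable _ T = <<s C >> -> setI_closed C ->
  measurable_fun setT p -> measurable D -> m.-integrable D F ->
  (\int[m]_(z in D) F z = 0)%E ->
  (forall S, C S -> (\int[m]_(z in D `&` p @^-1` S) F z = 0)%E) ->
  forall S, measurable S -> (\int[m]_(z in D `&` p @^-1` S) F z = 0)%E.
Proof.
move=> mT CI mp mD iF D0 C0 S mS.
have mDp B : measurable B -> measurable (D `&` p @^-1` B).
  move=> mB; apply: measurableI => //.
  by rewrite -[X in measurable X]setTI; exact: mp.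
(* The sets with vanishing integral form a Dynkin system: complements because the integral over [D]
   is 0, disjoint unions by countable additivity. Taking a projection for [p] varies a single
   coordinate. *)
apply: (dynkin_induction (P := fun S =>
    (\int[m]_(z in D `&` p @^-1` S) F z = 0)%E) mT CI) => //.
- by rewrite preimage_setT setIT.
- move=> B mB B0; rewrite -D0 -[in RHS](setIT D).
  have -> : [set: X] = p @^-1` B `|` p @^-1` (~` B).
    by rewrite -preimage_setU setUv preimage_setT.
  rewrite setIUr integral_setU//.
  + by rewrite [X in _ = (X + _)%E]B0 add0e.
  + exact: mDp.
  + by apply: mDp; exact: measurableC.
  + apply: measurable_funS mD _ (measurable_int _ iF).
    by rewrite -setIUr; exact: subIsetl.
  + by apply/disj_setPS => z [[_ Bz] [_ nBz]]; exact: nBz.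
- move=> K mK tK K0; rewrite preimage_bigcup setI_bigcupr integral_bigcup.
  + by apply: eseries0 => i _ _; exact: K0.
  + apply/trivIsetP => i j _ _ ij; rewrite setIACA setIid -preimage_setI.
    by move/trivIsetP : tK => /(_ i j I I ij) ->; rewrite preimage_set0 setI0.
  + by move=> k; exact: mDp.
  + apply: integrableS iF => //.
      by apply: bigcup_measurable => k _; exact: mDp.
    by move=> z [k _ []].
- by rewrite -mT.
Qed.

(* The library generates the product sigma-algebra by measurable rectangles, not
   by boxes: pass from intervals to measurable sets one coordinate at a time. *)
Lemma ae_eq0_boxes (F : plane R -> R) : measurable_fun setT F ->
  (forall s1 t1 s2 t2, leb2.-integrable (box s1 t1 s2 t2) (EFin \o F)) ->
  (forall s1 t1 s2 t2, \int[leb2]_(z in box s1 t1 s2 t2) (F z)%:E = 0)%E ->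
  {ae leb2, forall z, F z = 0}.
Proof.
move=> mF iF F0.
have mocitv : @measurable _ (measurableTypeR R) = <<s @ocitv R >> by [].
have ocI : setI_closed (@ocitv R) by exact: ocitvI.
(* The squares [Q n] exhaust the plane, so each can be treated alone. *)
pose Q (n : nat) := box (- n%:R) n%:R (- n%:R) n%:R.
suff Qn n : {ae leb2, forall z, Q n z -> F z = 0}.
  apply: filterS (ae_foralln Qn) => z Qz.
  pose n := Num.truncn (`|z.1 : R| + `|z.2 : R|).
  have zn : `|z.1 : R| + `|z.2 : R| < n.+1%:R by exact: truncnS_gt.
  have z1n : `|z.1 : R| < n.+1%:R by rewrite (le_lt_trans _ zn)// lerDl.
  have z2n : `|z.2 : R| < n.+1%:R by rewrite (le_lt_trans _ zn)// lerDr.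
  apply: (Qz n.+1).
  move: z1n z2n; rewrite !ltr_norml => /andP[? /ltW ?] /andP[? /ltW ?].
  by split; rewrite /= in_itv/=; apply/andP.
pose J : set (measurableTypeR R) := `]- n%:R, n%:R]%classic.
have mJ : measurable J by exact: measurable_itv.
(* First coordinate: [A] becomes arbitrary while [B] stays an interval. *)
have Jfst A B : measurable A -> (exists u v : R, B = `]u, v]%classic) ->
    (\int[leb2]_(z in (J `&` A) `*` B) (F z)%:E = 0)%E.
  move=> mA [u [v ->]].
  have := @integral_eq0_dynkin _ _ _ _ leb2 fst _ (box (- n%:R) n%:R u v) _
    mocitv ocI measurable_fst (measurable_box _ _ _ _) (iF _ _ _ _)
    (F0 _ _ _ _) _ A mA.
  have -> : box (- n%:R) n%:R u v `&` fst @^-1` A =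
      (J `&` A) `*` `]u, v]%classic.
    by apply/seteqP; split => z [[? ?] ?].
  apply=> S [[s t] _ <-].
  have [[u' v'] _ /= uv'] := ocitvI (is_ocitv (- n%:R) n%:R) (is_ocitv s t).
  rewrite (_ : _ `&` _ = box u' v' u v) ?F0//.
  rewrite /box uv'; apply/seteqP; split => z.
    by move=> [[? ?] ?]; do !split.
  by move=> [[? ?] ?]; do !split.
(* Second coordinate, with the first factor now fixed. *)
have JJ A B : measurable A -> measurable B ->
    (\int[leb2]_(z in (J `&` A) `*` (J `&` B)) (F z)%:E = 0)%E.
  move=> mA mB; have mJA : measurable (J `&` A) by exact: measurableI.
  have mD : measurable ((J `&` A) `*` J) by exact: measurableX.
  have iD : leb2.-integrable ((J `&` A) `*` J) (EFin \o F).
    apply: integrableS (iF (- n%:R) n%:R (- n%:R) n%:R) => //.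
      exact: measurable_box.
    by move=> z [[? ?] ?].
  have := @integral_eq0_dynkin _ _ _ _ leb2 snd _ ((J `&` A) `*` J) _ mocitv
    ocI measurable_snd mD iD _ _ B mB.
  have -> : (J `&` A) `*` J `&` snd @^-1` B = (J `&` A) `*` (J `&` B).
    apply/seteqP; split => z; first by move=> [[[? ?] ?] ?].
    by move=> [[? ?] [? ?]].
  apply; first by apply: Jfst => //; exists (- n%:R), n%:R.
  move=> S [[s t] _ <-].
  have [[u' v'] _ /= uv'] := ocitvI (is_ocitv (- n%:R) n%:R) (is_ocitv s t).
  rewrite (_ : _ `&` _ = (J `&` A) `*` `]u', v']%classic).
    by apply: Jfst => //; exists u', v'.
  rewrite uv'; apply/seteqP; split => z.
    by move=> [[[? ?] ?] ?].
  by move=> [[? ?] [? ?]].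
have mQ : measurable (Q n) by exact: measurable_box.
(* Measurable rectangles are closed under intersection and generate the product sigma-algebra; here
   [p] is the identity. *)
have QS S : measurable S -> (\int[leb2]_(z in Q n `&` S) (F z)%:E = 0)%E.
  apply: (@integral_eq0_dynkin _ _ _ _ leb2 id _ (Q n) _
    (measurable_prod_measurableType _ _)) => //.
  - move=> _ _ [A mA [B mB <-]] [A' mA' [B' mB' <-]].
    exists (A `&` A'); first exact: measurableI.
    by exists (B `&` B'); [exact: measurableI|rewrite setXI].
  - exact: iF.
  - exact: F0.
  - move=> _ [A mA [B mB <-]]; rewrite -(JJ A B)//.
    by congr (integral _ _ _); apply/seteqP; split => z [[? ?] [? ?]].
have := @integral_ae_eq _ _ _ leb2 (Q n) mQ (cst 0%E) (EFin \o F)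
  (iF _ _ _ _) _ _.
move=> /(_ _ _)/filterS; apply.
- by move=> z Fz /Fz [].
- exact: measurable_cst.
- move=> E EQ mE; rewrite integral0 -[in LHS](setIidr EQ); exact: QS.
Qed.

(** * Testing L^2 functions on boxes, and uniqueness *)

Lemma L2_indic_box s1 t1 s2 t2 : L2 (\1_(box s1 t1 s2 t2) : plane R -> R).
Proof.
have mB := measurable_box s1 t1 s2 t2.
apply/L2P; split; first exact: measurable_indic.
rewrite Lnorm2E poweR_lty//.
have [_] := integrableP _ _ _ (integrable_indic_box s1 t1 s2 t2).
apply: le_lt_trans; apply: ge0_le_integral => //.
- by apply/measurable_EFinP/measurable_funX; exact: measurable_indic.
- apply: measurableT_comp => //; apply/measurable_EFinP.
  exact: measurable_indic.
move=> z _; rewrite lee_fin indicE.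
by case: (_ \in _); rewrite ?expr1n ?expr0n ?normr1 ?normr0.
Qed.

Lemma integrable_mul_indic_box u s1 t1 s2 t2 : L2 u ->
  leb2.-integrable setT (EFin \o (u \* \1_(box s1 t1 s2 t2))).
Proof.
move=> Lu; apply/Lfun1_integrable; apply: Lfun2_mul_Lfun1 => //.
exact: L2_indic_box.
Qed.

Lemma restrict_indic_box u s1 t1 s2 t2 :
  (EFin \o u) \_ (box s1 t1 s2 t2) = EFin \o (u \* \1_(box s1 t1 s2 t2)).
Proof.
apply/funext => z; rewrite patchE /= indicE.
by case: ifP => _; rewrite ?mulr1 ?mulr0.
Qed.

Lemma L2_ae_eq0_boxes u : L2 u ->
  (forall s1 t1 s2 t2,
    \int[leb2]_z (u z * \1_(box s1 t1 s2 t2) z) = 0) ->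
  {ae leb2, forall z, u z = 0}.
Proof.
move=> Lu u0; have /L2P[mu _] := Lu.
apply: ae_eq0_boxes => // s1 t1 s2 t2.
  apply/integrable_mkcond; first exact: measurable_box.
  by rewrite restrict_indic_box; exact: integrable_mul_indic_box.
rewrite integral_mkcond restrict_indic_box.
have iu := integrable_mul_indic_box s1 t1 s2 t2 Lu.
by rewrite -[LHS]fineK ?(integrable_fin_num _ iu)//; congr EFin; exact: u0.
Qed.

(** By duality the real and [j] components of [G' - r G] have zero integral over every box, and the
    other two vanish anyway. With [r = 1] this is uniqueness of the transform; [r = -1] serves the
    opposite signs of the [k] components. *)
Lemma is_fourier_ae (r : R) g g' G G' : is_fourier g G -> is_fourier g' G' ->
  {ae leb2, forall x, g' x = r * g x} ->
  {ae leb2, forall f, G' f = r%:q * G f}.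
Proof.
move=> gG gG' gg.
have [Lg LG _] := gG; have [Lg' LG' _] := gG'.
have [L0 _ L2' _] := qL2_components LG.
have [L0' _ L2'' _] := qL2_components LG'.
have /L2P[mg _] := Lg; have /L2P[mg' _] := Lg'.
have Ls u w : L2 u -> L2 w -> L2 (fun f => u f - r * w f).
  move=> Lu Lw; have p1 : (1 <= 2%:E :> \bar R)%E by rewrite lee_fin ler1n.
  have [_ /(_ (- r) w u Lw Lu)] := Lfun_submod_closed (@leb2 R) p1.
  rewrite /L2; have -> // : - r *: w + u = (fun f => u f - r * w f).
  by apply/funext => f; rewrite !fctE scaleNr addrC.
have Ich w : L2 w -> \int[leb2]_x (g' x * w x) = r * \int[leb2]_x (g x * w x).
  move=> Lw; have /L2P[mw _] := Lw.
  have igw : leb2.-integrable setT (EFin \o (g \* w)).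
    by apply/Lfun1_integrable; exact: Lfun2_mul_Lfun1.
  rewrite -RintegralZl//; congr fine; apply: ae_eq_integral => //.
  - by apply/measurable_EFinP; exact: measurable_funM.
  - apply/measurable_EFinP; apply: measurable_funM => //.
    exact: measurable_funM.
  - by apply: filterS gg => x -> _; rewrite mulrA.
(* Common argument for the real component ([phi = 0]) and the [j] component ([phi = pi / 2]). *)
have part (p : quat R -> R) phi : L2 (p \o G) -> L2 (p \o G') ->
    (forall s1 t1 s2 t2, let h := \1_(box s1 t1 s2 t2) in
      \int[leb2]_f (p (G f) * h f) =
      \int[leb2]_x (g x * cos_transform phi h x)) ->
    (forall s1 t1 s2 t2, let h := \1_(box s1 t1 s2 t2) in
      \int[leb2]_f (p (G' f) * h f) =
      \int[leb2]_x (g' x * cos_transform phi h x)) ->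
    {ae leb2, forall f, p (G' f) = r * p (G f)}.
  move=> LpG LpG' E E'.
  have := L2_ae_eq0_boxes (Ls _ _ LpG' LpG).
  move=> H; apply: filterS (H _) => [f /eqP|s1 t1 s2 t2].
    by rewrite subr_eq0 => /eqP.
  under eq_Rintegral do rewrite mulrBl -mulrA.
  have i1 := integrable_mul_indic_box s1 t1 s2 t2 LpG.
  have i1' := integrable_mul_indic_box s1 t1 s2 t2 LpG'.
  rewrite RintegralB//; last exact: (integrableZl measurableT r i1).
  rewrite RintegralZl// [X in X - _]E' [X in _ - _ * X]E Ich ?subrr//.
  exact: L2_cos_transform_box.
have dual h0 H0 (hH : is_fourier h0 H0) s1 t1 s2 t2 :=
  is_fourier_duality hH (integrable_indic_box s1 t1 s2 t2)
    (L2_indic_box s1 t1 s2 t2)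
    (fun phi => L2_cos_transform_box phi s1 t1 s2 t2).
have re0 : {ae leb2, forall f, q_re (G' f) = r * q_re (G f)}.
  exact: (part q_re 0 L0 L0' (fun s1 t1 s2 t2 => (dual _ _ gG s1 t1 s2 t2).1)
    (fun s1 t1 s2 t2 => (dual _ _ gG' s1 t1 s2 t2).1)).
have j0 : {ae leb2, forall f, q_j (G' f) = r * q_j (G f)}.
  exact: (part q_j _ L2' L2'' (fun s1 t1 s2 t2 => (dual _ _ gG s1 t1 s2 t2).2)
    (fun s1 t1 s2 t2 => (dual _ _ gG' s1 t1 s2 t2).2)).
have := aeI (aeI re0 j0) (aeI (is_fourier_ik0 gG) (is_fourier_ik0 gG')).
apply: filterS => f [[]].
case: (G f) (G' f) => [? ? ? ?] [? ? ? ?] /= -> -> [[-> ->] [-> ->]].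
by congr Quat => /=; ring.
Qed.

End FourierUniqueness.

(** * Hypercomplex signals *)

Section HypercomplexFamily.
Context {R : realType}.
Implicit Types (x f b : plane R) (a theta : R).
Local Notation leb := (@lebesgue_measure R).

Lemma ae_off_axes : {ae @leb2 R, forall f, f.1 != 0 /\ f.2 != 0}.
Proof.
pose Z : set (measurableTypeR R) := [set 0].
have mZ : measurable Z by exact: measurable_set1.
have mZT : measurable (Z `*` setT : set (plane R)) by exact: measurableX.
have mTZ : measurable (setT `*` Z : set (plane R)) by exact: measurableX.
exists ((Z `*` setT) `|` (setT `*` Z)); split; first exact: measurableU.
  apply/eqP; rewrite -measure_le0; apply: le_trans (measureU2 _ _ _) _ => //.
  rewrite [X in (X + _)%E](product_measure1E leb leb)//.
  rewrite [X in (_ + X)%E](product_measure1E leb leb)//.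
  (* Each axis has measure [0 * +oo], which is 0 by convention. *)
  by rewrite /= lebesgue_measure_set1 mul0e mule0 adde0.
by move=> f /= /not_andP[]/negP; rewrite negbK => /eqP f0; [left|right].
Qed.

(** Both symbols are real multiples of [j], so either product is [- s1 s2 q] and the equation says
    [2 s1 s2 q = 0]. *)
Lemma hilbert_symbols_eq0 f (q : quat R) :
  f.1 != 0 -> f.2 != 0 ->
  hilbert_symbol fst f * (hilbert_symbol snd f * q) =
    - (hilbert_symbol snd f * (hilbert_symbol fst f * q)) -> q = 0.
Proof.
move=> f1 f2.
have : Num.sg f.1 * Num.sg f.2 != 0 by rewrite mulf_neq0// sgr_eq0.
rewrite /hilbert_symbol; move: (Num.sg f.1) (Num.sg f.2) => s1 s2 s12.
have -> : - qJ * s1%:q * (- qJ * s2%:q * q) = - ((s1 * s2)%:q * q).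
  by case: q => ? ? ? ?; congr Quat => /=; ring.
have -> : - qJ * s2%:q * (- qJ * s1%:q * q) = - ((s1 * s2)%:q * q).
  by case: q => ? ? ? ?; congr Quat => /=; ring.
rewrite opprK; case: q => x0 x1 x2 x3 E.
have z (y : R) : - (s1 * s2 * y) = s1 * s2 * y -> y = 0.
  move=> yE; have /eqP : s1 * s2 * y = 0 by lra.
  by rewrite mulf_eq0 (negbTE s12) => /eqP.
move: E; rewrite /=.
move=> -[] /=; rewrite !mul0r !subr0 !addr0 => /z-> /z-> /z-> /z->.
by [].
Qed.

Lemma plane_rotK theta : cancel (@plane_rot R theta) (plane_rot (- theta)).
Proof.
move=> [x1 x2]; rewrite /plane_rot cosN sinN /=; have := cos2Dsin2 theta.
move: (cos theta) (sin theta) => c s cs.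
by congr pair; [rewrite -[RHS]mul1r -cs|rewrite -[RHS]mul1r -cs]; ring.
Qed.

(** A transform vanishing almost everywhere would make the admissibility integral 0, against its
    strict lower bound. *)
Lemma admissible_fourier_neq0 (psi : plane R -> R) : admissible psi ->
  ~ (forall Psi, is_fourier psi Psi -> {ae leb2, forall f, qnorm (Psi f) = 0}).
Proof.
move=> [_ _ [Psi psiPsi /andP[+ _]]] /(_ _ psiPsi) Psi0.
have [_ /qL2P[mPsi _] _] := psiPsi.
rewrite [X in (_ * X)%E](_ : _ = 0%E) ?mule0 ?ltxx//.
rewrite -(integral0 (@leb2 R) setT); apply: ae_eq_integral => //.
  apply/measurable_EFinP; apply: measurable_funM.
    by apply: (measurable_funX 2); exact: qmeasurable_qnorm.
  (* The inverse, discontinuous at 0, is read as a real power, whose measurability is known. *)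
  under eq_fun do rewrite -powR_inv1 ?sqr_ge0//.
  apply: (measurableT_comp (measurable_powR _)); apply: (measurable_funX 2).
  apply: (@measurableT_comp _ _ _ _ _ _ (@Num.sqrt R)).
    by apply: continuous_measurable_fun => y; exact: sqrt_continuous.
  by apply: measurable_funD; apply: (measurable_funX 2).
by apply: filterS Psi0 => f -> _; rewrite expr0n mul0r.
Qed.

Lemma hypercomplex_family (psipp : plane R -> quat R) a theta b :
  hypercomplexing_mother_wavelet psipp -> 0 < a ->
  ~ exists2 h, L2 h &
    is_hypercomplex_signal theta h (family_member a theta b psipp).
Proof.
move=> [psi [psi1 [psi2 [psi21 [[adm _] H1 _ H21 E]]]]] a0.
move=> [h Lh [h1 [h2 [h12 [_ Hh2 Hh12 E']]]]].
have s0 : 0 < a^-1 by rewrite invr_gt0.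
pose c := family_shift a theta b.
(* Comparison of the real and [k] components; the factors [1] and [-1] give the form required by
   [is_fourier_ae]. *)
have hE : {ae leb2, forall x, h x = 1 * dilate a^-1 c psi x /\
    h12 x = -1 * dilate a^-1 c psi21 x}.
  have e := family_ae_preserving theta b a0 E.
  have hE : {ae leb2, forall x,
      let y := plane_rot (- theta) x in h y = 1 * dilate a^-1 c psi y /\
      h12 y = -1 * dilate a^-1 c psi21 y}.
    apply: filterS2 e E' => x Ex; rewrite family_memberE Ex => Eh.
    have := congr1 q_re Eh; have := congr1 q_k Eh.
    rewrite /rotate_fun /dilate /=.
    rewrite -/c; move: (psi _) (psi1 _) (psi2 _) (psi21 _).
    move: (h _) (h1 _) (h2 _) (h12 _).
    by move=> k k1 k2 k12 p p1 p2 p21 Ek Er; split; lra.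
  (* Rotating back removes the rotation from the argument. *)
  have := plane_rot_ae_preserving theta hE.
  by apply: filterS => x; rewrite plane_rotK.
have hE1 : {ae leb2, forall x, h x = 1 * dilate a^-1 c psi x}.
  by apply: filterS hE => x [].
have hE2 : {ae leb2, forall x, h12 x = -1 * dilate a^-1 c psi21 x}.
  by apply: filterS hE => x [].
have refl1 (u : plane R -> R) : {ae leb2, forall x, u x = 1 * u x}.
  by apply: aeW => x; rewrite mul1r.
have [G1 [U1 [psiG1 psi1U1 e1]]] := is_hilbert1_dilate c s0 H1.
have [G2 [U2 [psi1G2 psi21U2 e2]]] := is_hilbert2_dilate c s0 H21.
have [K1 [K2 [hK1 h2K2 e3]]] := Hh2.
have [K3 [K4 [h2K3 h12K4 e4]]] := Hh12.
(* Every multiplier relation carries its own transforms; these four identities match those of the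
   same function, or of its negative. *)
have q1 := is_fourier_ae psiG1 hK1 hE1.
have q2 := is_fourier_ae psi1U1 psi1G2 (refl1 _).
have q3 := is_fourier_ae h2K2 h2K3 (refl1 _).
have q4 := is_fourier_ae psi21U2 h12K4 hE2.
have G10 : {ae leb2, forall f, qnorm (G1 f) = 0}.
  (* The transform of [h12] is computed twice: through [h2], and through [psi21] with the sign
     reversed. *)
  have e1234 : {ae leb2, forall f,
      hilbert_symbol fst f * (hilbert_symbol snd f * G1 f) =
      - (hilbert_symbol snd f * (hilbert_symbol fst f * G1 f))}.
    have := aeI (aeI (aeI e1 e2) (aeI e3 e4)) (aeI (aeI q1 q2) (aeI q3 q4)).
    apply: filterS => f [[[U1E U2E] [K2E K4E]] [[K1E G2E] [K3E]]].
    rewrite K4E K3E K2E K1E U2E G2E U1E !mul1r => ->.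
    by case: (hilbert_symbol snd f * _) => ? ? ? ?; congr Quat => /=; ring.
  apply: filterS2 ae_off_axes e1234 => f [f1 f2].
  move/(hilbert_symbols_eq0 f1 f2) => ->.
  by rewrite /qnorm /= !expr0n !addr0 sqrtr0.
apply: (admissible_fourier_neq0 adm) => Psi psiPsi.
(* [G1] is a transform of the dilated [psi], hence agrees with the dilation of any transform [Psi]
   of [psi]. *)
have := is_fourier_ae psiG1 (is_fourier_dilate c s0 psiPsi) (refl1 _).
move=> D0.
have {}D0 : {ae leb2, forall f, qnorm (Psi (affine_map a^-1^-1 (0, 0) f)) = 0}.
  apply: filterS2 G10 D0 => f G0.
  move/(congr1 qnorm); rewrite qnorm_dilate_fourier// [RHS](_ : _ = 0).
    by rewrite /dilate /= => /eqP; rewrite mulf_eq0 !invr_eq0 gt_eqF//= => /eqP.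
  by rewrite -[RHS]G0; congr qnorm; rewrite mul1r.
(* Composing with the inverse dilation returns from the dilated argument to [f]. *)
have := affine_map_ae_preserving (0, 0) s0 D0; apply: filterS => f.
congr (qnorm (Psi _) = 0); case: f => f1 f2.
rewrite /affine_map /= !addr0 !mulrA invrK divff ?mul1r// gt_eqF//.
Qed.
End HypercomplexFamily.

Theorem theorem3 (R : realType) :
  (forall (psi : plane R -> R) (psip : plane R -> quat R),
     admissible psi -> is_monogenic_extension psi psip ->
     forall (a theta : R) (b : plane R), 0 < a -> 0 <= theta < 2 * pi ->
     exists2 h : plane R -> R, L2 h &
       is_monogenic_signal theta h (family_member a theta b psip)) /\
  (forall psipp : plane R -> quat R,
     hypercomplexing_mother_wavelet psipp ->
     forall (a theta : R) (b : plane R), 0 < a -> 0 <= theta < 2 * pi ->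
     ~ exists2 h : plane R -> R, L2 h &
       is_hypercomplex_signal theta h (family_member a theta b psipp)).
Proof.
split=> [psi psip [Lpsi _ _] ext a theta b a0 _|psipp mother a theta b a0 _].
  exact: monogenic_family ext a0.
exact: hypercomplex_family.
Qed.
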